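(* Let $T_{RCF}$ and $T_{OCF}$ be the forward shifts on the regular continued fraction digits and on the odd continued fraction digits, respectively, acting on $\Omega=[0,1)\setminus\mathbb{Q}$. Then $T_{RCF}$ and $T_{OCF}$ are normal-equivalent; that is, a point $x\in\Omega$ is $T_{RCF}$-normal if and only if it is $T_{OCF}$-normal.
   Context: Let $\Omega=[0,1)\setminus\mathbb{Q}$ with the Borel $\sigma$-algebra. Normality. Let $T:\Omega\to\Omega$ be a map with invariant ergodic probability measure $\mu$ and a partition $\{I_d\}_{d\in\mathcal{D}}$ of $\Omega$ such that $T_d:=T|_{I_d}$ is injective. For a finite string of digits $s=[d_1,\dots,d_l]$, $d_i\in\mathcal{D}$, the cylinder set is $C_s=T_{d_1}^{-1}T_{d_2}^{-1}\cdots T_{d_l}^{-1}\Omega$, i.e. the set of $x\in\Omega$ with $T^{i-1}x\in I_{d_i}$ for $1\le i\le l$; $s$ is admissible if $C_s\neq\emptyset$. A point $x\in\Omega$ is $T$-normal if for all admissible strings $s$, $$\lim_{N\to\infty}\frac{\#\{0\le n<N \mid T^n x\in C_s\}}{N}=\mu(C_s).$$ Regular continued fractions (RCF). $T_{RCF}\,x=\frac1x-\lfloor\frac1x\rfloor$, digit set $\mathcal{D}=\mathbb{N}=\{1,2,\dots\}$, partition $I_n=(\frac1{n+1},\frac1n]$ (intersected with $\Omega$), and measure $\mu_{RCF}(A)=\frac1{\log2}\int_A\frac{1}{1+x}\,dx$. Odd continued fractions (OCF). $$T_{OCF}\,x=\begin{cases}\frac1x-\lfloor\frac1x\rfloor &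 \text{if }\lfloor 1/x\rfloor\text{ is odd},\\ 1-\frac1x+\lfloor\frac1x\rfloor & \text{if }\lfloor 1/x\rfloor\text{ is even},\end{cases}$$ digit set $\mathcal{D}=(\mathbb{N}_{odd}\times\{\pm1\})\setminus\{(1,-1)\}$, partition $I_{(a,+1)}=[\frac1{a+1},\frac1a)$ and $I_{(a,-1)}=[\frac1a,\frac1{a-1})$ (intersected with $\Omega$), and measure $$\mu_{OCF}(A)=\frac1{3\log G}\int_A\left(\frac1{G+x-1}+\frac1{G+1-x}\right)dx,\qquad G=\frac{1+\sqrt5}{2}.$$ *)

(* Defs.v *)
From mathcomp Require Import all_boot all_order all_algebra.
From mathcomp Require Import all_classical all_reals all_analysis.

Set Implicit Arguments.
Unset Strict Implicit.
Unset Printing Implicit Defensive.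

Import Order.TTheory GRing.Theory Num.Theory.
Import numFieldNormedType.Exports.

Local Open Scope classical_set_scope.
Local Open Scope ring_scope.

(** Maps on [0,1) \ Q are given as functions on R; only their values on
    [Omega] matter. *)
Definition Omega {R : realType} : set R := `[0, 1[ `&` @irrational R.

Section Normality.
Variables (R : realType) (D : Type).
Variables (T : R -> R) (I : D -> set R) (mu : set R -> \bar R).

(** C_[d_1, ..., d_l] = T_{d_1}^{-1} (... (T_{d_l}^{-1} Omega)), where T_d is
    the restriction of T to I d. *)
Fixpoint cylinder (s : seq D) : set R :=
  if s is d :: s' then I d `&` T @^-1` (cylinder s') else Omega.

Definition admissible (s : seq D) : Prop := cylinder s !=set0.

Definition visit_count (x : R) (C : set R) (N : nat) : nat :=
  #|[pred n : 'I_N | iter n T x \in C]|.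

Definition normal_point (x : R) : Prop :=
  forall s : seq D, admissible s ->
    (((visit_count x (cylinder s) N)%:R / N%:R : R)%:E)
      @[N --> \oo] --> mu (cylinder s).

End Normality.

Section RegularContinuedFractions.
Variable R : realType.

Definition T_RCF (x : R) : R := x^-1 - (Num.floor x^-1)%:~R.

Definition digit_RCF : Type := {n : nat | (0 < n)%N}.

Definition I_RCF (d : digit_RCF) : set R :=
  let n : R := (val d)%:R in `](n + 1)^-1, n^-1] `&` Omega.

Definition mu_RCF (A : set R) : \bar R :=
  (((ln 2)^-1)%:E * \int[lebesgue_measure]_(x in A) ((1 + x)^-1)%:E)%E.

Definition RCF_normal : R -> Prop := normal_point T_RCF I_RCF mu_RCF.

End RegularContinuedFractions.

Section OddContinuedFractions.
Variable R : realType.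

Definition T_OCF (x : R) : R :=
  if odd `|Num.floor x^-1|%N then x^-1 - (Num.floor x^-1)%:~R
  else 1 - x^-1 + (Num.floor x^-1)%:~R.

Definition is_digit_OCF (d : nat * int) : bool :=
  [&& odd d.1, (d.2 == 1) || (d.2 == -1) & d != (1%N, -1)].

Definition digit_OCF : Type := {d : nat * int | is_digit_OCF d}.

Definition I_OCF (d : digit_OCF) : set R :=
  let a : R := (val d).1%:R in
  (if (val d).2 == 1 then `[(a + 1)^-1, a^-1[%classic
   else `[a^-1, (a - 1)^-1[%classic)
  `&` Omega.

Definition golden : R := (1 + Num.sqrt 5) / 2.

Definition mu_OCF (A : set R) : \bar R :=
  (((3 * ln golden)^-1)%:E *
   \int[lebesgue_measure]_(x in A)
     ((golden + x - 1)^-1 + (golden + 1 - x)^-1)%:E)%E.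

Definition OCF_normal : R -> Prop := normal_point T_OCF I_OCF mu_OCF.

End OddContinuedFractions.

Definition normal_equivalent (R : realType) (normal1 normal2 : R -> Prop) :=
  forall x : R, Omega x -> (normal1 x <-> normal2 x).

(* Main.v *)
Require Import Defs.
From mathcomp Require Import all_boot all_order all_algebra.
From mathcomp Require Import all_classical all_reals all_analysis.
From mathcomp Require Import measurable_realfun.
From mathcomp Require Import ring lra zify.

Set Implicit Arguments.
Unset Strict Implicit.
Unset Printing Implicit Defensive.

Import Order.TTheory GRing.Theory Num.Theory.
Import numFieldNormedType.Exports.

Local Open Scope classical_set_scope.
Local Open Scope ring_scope.

Local Notation "\1( b )" := (nat_of_bool b%R)%:R (at level 0, format "\1( b )").

(** Let t_n be the RCF remainders of x and a_n the RCF digits.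

    The OCF remainders of x are produced from the RCF digits by a transducer
    with three phases.  In phase Direct the current OCF remainder is t_n, in
    phase Mirror it is 1 - t_n, and in phase Wait the remainder last emitted is
    t_n / (1 + t_n) and one more RCF digit must be read.  Each RCF digit emits
    zero, one or two OCF remainders, so the two clocks run at comparable speed
    (lemma cesaro_time_change), and both normalities can be read off the
    distribution of the pairs (phase at n, t_n).

    Normality is first turned into equidistribution (normal_equidistributed):
    the frequency of t_n < c must be F c for all rational c, where F is the
    distribution function of the invariant measure.  Frequencies are then
    studied through the means obtained as limits of Cesaro means along
    ultrafilters: these always exist, are additive and shift-invariant, and
    jointly detect convergence.  For such a mean let A, B, W be the
    distribution functions of t_n restricted to the three phases.  Shift
    invariance and the transducer give linear relations between A, B, W, the
    total distribution A + B + W and the distribution of the emitted OCF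
    remainders (wait_cdfE, emitted_cdfE).  With G the golden ratio, they show
    that if B c is proportional to ln (G + c) - ln G, and A c to ln (1 + c)
    with the same factor, then A + B + W is the RCF distribution and the
    emitted points have the OCF distribution, up to normalization.

    From OCF to RCF: phase Mirror is entered exactly after an OCF digit with
    sign -1, so B is the distribution of the OCF remainders with such a digit,
    read one step later; it is a telescoping series (mirror_of_ocf).

    From RCF to OCF: the phase is Direct exactly when the number of even
    digits read so far is even.  The point is that this parity is
    asymptotically independent of t_n (parity_cancellation).  By the
    van der Corput trick the square of a signed frequency is bounded by
    correlations of the parity sign over long digit blocks.  The RCF measure
    is at most 1 / ln 2 times Lebesgue measure, and under Lebesgue measure
    digit sums are iterates of explicit operators in the variable
    r = q_(n-1) / q_n.  The operator twisted by the parity sign contracts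
    (parity_operator_tame), so the correlations decay exponentially.  Hence
    A is half of the RCF distribution, and B is the only solution of the
    resulting functional equation (mirror_of_rcf). *)

(** * Shift-invariant means *)

Section Means.
Variable R : realType.
Implicit Types (f g : nat -> R) (m : (nat -> R) -> R).

Definition bounded_seq f := exists M : R, forall n, `|f n| <= M.

Lemma bnd_cst c : bounded_seq (fun=> c).
Proof. by exists `|c|. Qed.

Lemma bndD f g : bounded_seq f -> bounded_seq g -> bounded_seq (fun n => f n + g n).
Proof.
move=> [M hM] [K hK]; exists (M + K) => n.
by rewrite (le_trans (ler_normD _ _))// lerD.
Qed.

Lemma bndM f g : bounded_seq f -> bounded_seq g -> bounded_seq (fun n => f n * g n).
Proof. by move=> [M hM] [K hK]; exists (M * K) => n; rewrite normrM ler_pM. Qed.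

Lemma bndN f : bounded_seq f -> bounded_seq (fun n => - f n).
Proof. by move=> [M hM]; exists M => n; rewrite normrN. Qed.

Lemma bnd_sum (I : Type) (r : seq I) (P : pred I) (F : I -> nat -> R) :
  (forall i, bounded_seq (F i)) -> bounded_seq (fun n => \sum_(i <- r | P i) F i n).
Proof.
move=> hF; elim: r => [|i r IH].
  by exists 0 => n; rewrite big_nil normr0.
have [M hM] := IH; have [K hK] := hF i.
exists (K + M) => n; rewrite big_cons; case: ifP => _.
  by rewrite (le_trans (ler_normD _ _))// lerD.
by rewrite (le_trans (hM n))// lerDr (le_trans (normr_ge0 _) (hK n)).
Qed.

Lemma bnd_nat (b : nat -> bool) : bounded_seq (fun n => (b n)%:R).
Proof. by exists 1 => n; case: (b n); rewrite ?normr1 ?normr0. Qed.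

Lemma bnd_shift f k : bounded_seq f -> bounded_seq (fun n => f (n + k)%N).
Proof. by move=> [M hM]; exists M => n. Qed.

(** An asymptotic average, for all bounded sequences, whether or not their
    Cesaro means converge. *)
Record invariant_mean m : Prop := InvariantMean {
  mean_linear : forall c f g, bounded_seq f -> bounded_seq g ->
    m (fun n => c * f n + g n) = c * m f + m g;
  mean_ge0 : forall f, bounded_seq f -> (forall n, 0 <= f n) -> 0 <= m f;
  mean_one : m (fun=> 1) = 1;
  mean_shift1 : forall f, bounded_seq f -> m (fun n => f n.+1) = m f
}.

Section MeanTheory.
Variables (m : (nat -> R) -> R) (hm : invariant_mean m).

Lemma mean_zero : m (fun=> 0) = 0.
Proof.
have := mean_linear hm 1 (bnd_cst 0) (bnd_cst 0).
by under eq_fun do rewrite mul1r addr0; lra.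
Qed.

Lemma meanZ c f : bounded_seq f -> m (fun n => c * f n) = c * m f.
Proof.
move=> bf; have := mean_linear hm c bf (bnd_cst 0).
by under eq_fun do rewrite addr0; rewrite mean_zero addr0.
Qed.

Lemma meanD f g : bounded_seq f -> bounded_seq g -> m (fun n => f n + g n) = m f + m g.
Proof.
move=> bf bg; have := mean_linear hm 1 bf bg.
by under eq_fun do rewrite mul1r; rewrite mul1r.
Qed.

Lemma meanN f : bounded_seq f -> m (fun n => - f n) = - m f.
Proof.
by move=> bf; rewrite -mulN1r -meanZ//; under eq_fun do rewrite -mulN1r.
Qed.

Lemma meanB f g : bounded_seq f -> bounded_seq g -> m (fun n => f n - g n) = m f - m g.
Proof. by move=> bf bg; rewrite meanD ?meanN//; exact: bndN. Qed.

Lemma mean_cst c : m (fun=> c) = c.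
Proof.
by have := meanZ c (bnd_cst 1); rewrite mean_one// !mulr1.
Qed.

Lemma mean_sum (I : Type) (r : seq I) (P : pred I) (F : I -> nat -> R) :
  (forall i, bounded_seq (F i)) ->
  m (fun n => \sum_(i <- r | P i) F i n) = \sum_(i <- r | P i) m (F i).
Proof.
move=> hF; elim: r => [|i r IH].
  by rewrite big_nil; under eq_fun do rewrite big_nil; exact: mean_zero.
rewrite big_cons; under eq_fun do rewrite big_cons.
by case: (P i) => //; rewrite meanD ?IH//; exact: bnd_sum.
Qed.

Lemma mean_le f g : bounded_seq f -> bounded_seq g -> (forall n, f n <= g n) -> m f <= m g.
Proof.
move=> bf bg fg; rewrite -subr_ge0 -meanB//; apply: mean_ge0 => //.
  by apply: bndD => //; exact: bndN.
by move=> n; rewrite subr_ge0.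
Qed.

Lemma mean_shift f k : bounded_seq f -> m (fun n => f (n + k)%N) = m f.
Proof.
move=> bf; elim: k => [|k IH]; first by under eq_fun do rewrite addn0.
rewrite -IH -(mean_shift1 hm (bnd_shift k bf)).
by under eq_fun do rewrite addnS -addSn.
Qed.

(** The variance is nonnegative: expand the mean of (f - m f)^2. *)
Lemma mean_sqr f : bounded_seq f -> m f ^+ 2 <= m (fun n => f n ^+ 2).
Proof.
move=> bf; have bff : bounded_seq (fun n => f n ^+ 2) by exact: bndM.
have := mean_ge0 hm (f := fun n => f n ^+ 2 - (2 * m f * f n - m f ^+ 2)).
have b1 : bounded_seq (fun n => 2 * m f * f n) by apply: bndM => //; exact: bnd_cst.
have b2 : bounded_seq (fun n => 2 * m f * f n - m f ^+ 2).
  by apply: bndD => //; apply: bndN; exact: bnd_cst.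
rewrite meanB// meanB ?mean_cst ?meanZ//; last exact: bnd_cst.
move=> H; have : 0 <= m (fun n => f n ^+ 2) - (2 * m f * m f - m f ^+ 2).
  apply: H => [|n]; first by apply: bndD => //; exact: bndN.
  by have := sqr_ge0 (f n - m f); rewrite !expr2; lra.
by rewrite !expr2; lra.
Qed.

End MeanTheory.

Definition cesaro f (N : nat) : R := (\sum_(n < N) f n) / N%:R.

Lemma cesaro_bound f M : (forall n, `|f n| <= M) -> forall N, `|cesaro f N| <= M.
Proof.
move=> hM [|N].
  by rewrite /cesaro big_ord0 mul0r normr0 (le_trans (normr_ge0 (f 0%N))).
rewrite /cesaro normrM normfV normr_nat ler_pdivrMr ?ltr0n//.
apply: le_trans (ler_norm_sum _ _ _) _.
apply: (@le_trans _ _ (\sum_(i < N.+1) M)); first by apply: ler_sum => i _; exact: hM.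
by rewrite sumr_const card_ord mulr_natr.
Qed.

Definition ultra_mean (U : set_system nat) f : R := lim (cesaro f @ U).

Section UltraMean.
Variables (U : set_system nat) (hU : UltraFilter U) (Uoo : \oo `<=` U).

(** The Cesaro means stay in a compact segment, where every ultrafilter
    converges. *)
Lemma ultra_mean_cvg f : bounded_seq f -> cesaro f @ U --> ultra_mean U f.
Proof.
move=> [M hM]; apply/cvg_ex => /=.
have FU : ProperFilter (cesaro f @ U) by exact: fmap_proper_filter.
have [|p [_ clp]] := @segment_compact R (- M) M (cesaro f @ U) FU.
  apply: (@filterS _ U _ setT); last exact: filterT.
  by move=> N _ /=; rewrite in_itv/= -ler_norml; exact: cesaro_bound hM N.
exists p => A Ap; have [//|nA] := in_ultra_setVsetC (cesaro f @^-1` A) hU.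
by have [y [/= ? ?]] := clp (~` A) A nA Ap.
Qed.

Lemma ultra_mean_eq f l : cesaro f @ \oo --> l -> ultra_mean U f = l.
Proof. by move=> fl; apply: cvg_lim => //; apply: cvg_trans fl => A /Uoo. Qed.

(** The sum telescopes. *)
Lemma cesaro_shift f : bounded_seq f -> cesaro (fun n => f n.+1 - f n) @ \oo --> (0 : R).
Proof.
move=> [M hM]; have M0 : 0 <= M := le_trans (normr_ge0 (f 0%N)) (hM 0%N).
have hN N : `|cesaro (fun n => f n.+1 - f n) N| <= 2 * M * N%:R^-1.
  rewrite /cesaro normrM normfV normr_nat ler_wpM2r ?invr_ge0//.
  rewrite -(big_mkord xpredT (fun n => f n.+1 - f n)) telescope_sumr//.
  by rewrite (le_trans (ler_normB _ _))// mulr_natl mulr2n lerD.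
apply/norm_cvg0P; apply: (@squeeze_cvgr _ _ _ _ (fun=> 0) (fun N => 2 * M * N%:R^-1)).
- by apply: filterS filterT => N _; rewrite normr_ge0 hN.
- exact: cvg_cst.
- rewrite -[X in _ --> X](mulr0 (2 * M)); apply: cvgM; first exact: cvg_cst.
  by rewrite -cvg_shiftS; exact: cvg_harmonic.
Qed.

Lemma ultra_mean_invariant : invariant_mean (ultra_mean U).
Proof.
have lin c f g : bounded_seq f -> bounded_seq g ->
    ultra_mean U (fun n => c * f n + g n) = c * ultra_mean U f + ultra_mean U g.
  move=> bf bg; apply: cvg_lim => //.
  have -> : cesaro (fun n => c * f n + g n) = fun N => c * cesaro f N + cesaro g N.
    by apply/funext => N; rewrite /cesaro big_split/= -mulr_sumr mulrDl mulrA.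
  by apply: cvgD; [apply: cvgM; [exact: cvg_cst|]|]; exact: ultra_mean_cvg.
split=> [||| f bf] //.
- move=> f bf f0; apply: limr_ge; first exact: cvgP (ultra_mean_cvg bf).
  apply: (@filterS _ U _ setT); last exact: filterT.
  by move=> N _; rewrite /cesaro mulr_ge0 ?invr_ge0// sumr_ge0.
- apply: ultra_mean_eq; rewrite -[X in _ --> X]/((fun=> 1) 0%N).
  apply: cvg_near_cst; exists 1%N => // N /= N0.
  by rewrite /cesaro sumr_const card_ord mulfV// pnatr_eq0 -lt0n.
- have bS : bounded_seq (fun n => f n.+1) by have [M hM] := bf; exists M.
  have := ultra_mean_eq (cesaro_shift bf).
  have := lin (-1) _ _ bf bS.
  under eq_fun do rewrite mulN1r addrC; move=> -> /eqP.
  by rewrite mulN1r addrC subr_eq0 => /eqP.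
Qed.

End UltraMean.

(** If the Cesaro means avoided a neighbourhood of l infinitely often, an
    ultrafilter containing these times would give a mean other than l. *)
Lemma cesaro_cvgP f l : bounded_seq f ->
  (forall U, UltraFilter U -> \oo `<=` U -> ultra_mean U f = l) ->
  cesaro f @ \oo --> l.
Proof.
move=> bf hl A Al; apply: contrapT => nA.
pose B := ~` (cesaro f @^-1` A).
have FF : ProperFilter (within B \oo).
  apply: Build_ProperFilter_ex => //.
  move=> P PB; apply: contrapT => nP; apply: nA.
  have : \forall N \near \oo, B N -> P N by exact: PB.
  rewrite /nbhs/=; apply: filterS => N /= BP.
  by apply: contrapT => nAN; apply: nP; exists N; exact: BP.
have [U [hU FU]] := ultraFilterLemma FF.
have Uoo : \oo `<=` U.
  move=> P oP; apply: FU; rewrite /within/=.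
  by apply: (@filterS _ \oo _ P) => // N PN _.
have UB : U B.
  by apply: FU; rewrite /within/=; apply: (@filterS _ \oo _ setT) => //; exact: filterT.
have := ultra_mean_cvg hU bf; rewrite (hl U)// => /(_ A Al) UA.
have {}UA : U (cesaro f @^-1` A) by exact: UA.
by have [N [/= ? ?]] := filter_ex (filterI UA UB).
Qed.

Lemma cesaro_mean_iff (f : nat -> R) (l : R) : bounded_seq f ->
  cesaro f @ \oo --> l <->
  forall U, UltraFilter U -> \oo `<=` U -> ultra_mean U f = l.
Proof.
move=> bf; split=> [h U hU Uoo|h]; first exact: ultra_mean_eq.
exact: cesaro_cvgP.
Qed.

End Means.

(** * Continued fraction maps and their cylinders *)

Section Rational.
Variable R : realType.
Implicit Types x y : R.

Lemma rational_nat n : rational (n%:R : R).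
Proof. by exists n%:R; rewrite // ratr_nat. Qed.

Lemma rationalD x y : rational x -> rational y -> rational (x + y).
Proof. by move=> [p _ <-] [q _ <-]; exists (p + q); rewrite // rmorphD. Qed.

Lemma rationalN x : rational x -> rational (- x).
Proof. by move=> [p _ <-]; exists (- p); rewrite // rmorphN. Qed.

Lemma rationalB x y : rational x -> rational y -> rational (x - y).
Proof. by move=> hx hy; apply: rationalD => //; exact: rationalN. Qed.

Lemma rationalM x y : rational x -> rational y -> rational (x * y).
Proof. by move=> [p _ <-] [q _ <-]; exists (p * q); rewrite // rmorphM. Qed.

Lemma rationalV x : rational x -> rational x^-1.
Proof. by move=> [p _ <-]; exists p^-1; rewrite // fmorphV. Qed.

Lemma OmegaP x : Omega x <-> [/\ 0 < x, x < 1 & ~ rational x].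
Proof.
split=> [[/=]|[x0 x1 nx]]; last by split=> //=; rewrite in_itv/= ltW.
rewrite in_itv/= => /andP[x0 x1] nx; split=> //.
rewrite lt_neqAle x0 andbT; apply/eqP => x0E; apply: nx.
by rewrite -x0E; exact: (rational_nat 0).
Qed.

Lemma irrational_neq x y : ~ rational x -> rational y -> x != y.
Proof. by move=> nx ry; apply/eqP => xy; apply: nx; rewrite xy. Qed.

End Rational.

Section ContinuedFractionMaps.
Variable R : realType.
Implicit Types (x y z a b c : R) (j : nat) (w : seq nat).

Definition quot x : nat := `|Num.floor x^-1|%N.

Lemma quot_eq x j : j%:R <= x^-1 < j.+1%:R -> quot x = j.
Proof.
move=> h; rewrite /quot (@floor_def _ _ (j : int)) ?absz_nat//.
by rewrite intrD -!pmulrn natr1.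
Qed.

Lemma quot_floor x : Omega x -> (quot x)%:R = (Num.floor x^-1)%:~R :> R.
Proof.
by move=> /OmegaP[x0 _ _]; rewrite /quot pmulrn gez0_abs// floor_ge0 invr_ge0 ltW.
Qed.

Lemma quot_itv x : Omega x ->
  [/\ (0 < quot x)%N, (quot x)%:R < x^-1 & x^-1 < (quot x).+1%:R].
Proof.
move=> hx; have /OmegaP[x0 x1 nx] := hx.
have fx := quot_floor hx.
have h1 : (quot x)%:R <= x^-1 by rewrite fx floor_le_tmp.
have h2 : x^-1 < (quot x).+1%:R by rewrite -natr1 fx -[1]/(1%:~R) -intrD floorD1_gt.
split=> //.
  rewrite -(ltr_nat R) -(ltrD2r 1) add0r natr1; apply: lt_trans h2.
  by rewrite invf_gt1.
rewrite lt_neqAle h1 andbT eq_sym; apply: irrational_neq; last exact: rational_nat.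
by move/rationalV; rewrite invrK.
Qed.

Variable e : pred nat.

(** The fractional part of 1/x, reflected when e selects the quotient: e is
    empty for the regular expansion and consists of the even numbers for the
    odd one, whose digit is determined by this quotient. *)
Definition cfmap x : R :=
  let z := x^-1 - (quot x)%:R in if e (quot x) then 1 - z else z.

(** The inverse of cfmap on the points with quotient j. *)
Definition branch j z : R := (if e j then j.+1%:R - z else j%:R + z)^-1.

Lemma branch_cfmap x : Omega x -> branch (quot x) (cfmap x) = x.
Proof.
move=> hx; rewrite /branch /cfmap; case: (e (quot x)).
  by rewrite -[RHS]invrK -natr1; congr (_^-1); ring.
by rewrite -[RHS]invrK; congr (_^-1); ring.
Qed.

Lemma cfmap_Omega x : Omega x -> Omega (cfmap x).
Proof.
move=> hx; have [j0 h1 h2] := quot_itv hx.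
move: hx => /OmegaP[x0 x1 nx]; apply/OmegaP.
have nz : ~ rational (x^-1 - (quot x)%:R).
  move=> rz; apply: nx; rewrite -[x]invrK -[x^-1](subrK (quot x)%:R).
  by apply/rationalV/rationalD => //; exact: rational_nat.
move: h2; rewrite -natr1 /cfmap => h2; case: ifP => _; last by split=> //; lra.
split; [lra|lra|move=> rz; apply: nz].
by rewrite -[X in rational X](subKr 1); apply: rationalB => //; exact: (rational_nat _ 1).
Qed.

Lemma branch_den j z : (0 < j)%N -> 0 <= z <= 1 ->
  j%:R <= (if e j then j.+1%:R - z else j%:R + z) <= j.+1%:R.
Proof. by move=> j0; rewrite -natr1; case: ifP => _ /andP[]; lra. Qed.

Lemma branch_den_gt0 j z : (0 < j)%N -> 0 <= z <= 1 ->
  0 < (if e j then j.+1%:R - z else j%:R + z).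
Proof.
move=> j0 /(branch_den j0)/andP[+ _]; apply: lt_le_trans.
by rewrite ltr0n.
Qed.

Lemma branch_itv j z : (0 < j)%N -> 0 <= z <= 1 ->
  j.+1%:R^-1 <= branch j z <= j%:R^-1.
Proof.
move=> j0 hz; have /andP[h1 h2] := branch_den j0 hz; have h0 := branch_den_gt0 j0 hz.
by rewrite /branch !lef_pV2 ?posrE ?ltr0n// h2.
Qed.

Lemma branch_01 j z : (0 < j)%N -> 0 <= z <= 1 -> 0 <= branch j z <= 1.
Proof.
move=> j0 /(branch_itv j0)/andP[h1 h2]; apply/andP; split.
  by apply: le_trans h1; rewrite invr_ge0.
by apply: (le_trans h2); rewrite invf_le1 ?ltr0n// ler1n.
Qed.

Lemma rational_branch j z : rational z -> rational (branch j z).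
Proof.
by move=> rz; rewrite /branch; case: ifP => _; apply: rationalV;
  [apply: rationalB|apply: rationalD] => //; exact: rational_nat.
Qed.

Lemma branch_lt j y z : (0 < j)%N -> 0 <= y <= 1 -> 0 <= z <= 1 ->
  (branch j y < branch j z) = if e j then y < z else z < y.
Proof.
move=> j0 hy hz; have y0 := branch_den_gt0 j0 hy; have z0 := branch_den_gt0 j0 hz.
rewrite /branch ltf_pV2 ?posrE//; case: ifP => _; first by rewrite ltrD2l ltrN2.
by rewrite ltrD2l.
Qed.

Lemma OmegaW x : Omega x -> 0 <= x <= 1.
Proof. by move=> /OmegaP[/ltW -> /ltW ->]. Qed.

Lemma branch_Omega j z : (0 < j)%N -> Omega z -> Omega (branch j z).
Proof.
move=> j0 hz; have z01 := OmegaW hz; move: hz => /OmegaP[z0 z1 nz]; apply/OmegaP.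
have d0 := branch_den_gt0 j0 z01.
have d1 : 1 < (if e j then j.+1%:R - z else j%:R + z).
  have : 1 <= j%:R :> R by rewrite ler1n.
  by case: ifP => _; rewrite -?natr1; lra.
rewrite /branch; split; rewrite ?invr_gt0 ?invf_lt1//.
move=> /rationalV; rewrite invrK; case: ifP => _ rz; apply: nz.
  by rewrite -[z](subKr j.+1%:R); apply: rationalB => //; exact: rational_nat.
by rewrite -[z](addKr j%:R) addrC; apply: rationalB => //; exact: rational_nat.
Qed.

Lemma quot_branch j z : (0 < j)%N -> Omega z -> quot (branch j z) = j.
Proof.
move=> j0 /OmegaP[z0 z1 _]; apply: quot_eq.
by rewrite /branch invrK; case: ifP => _; rewrite -?natr1; lra.
Qed.

Definition between a b x := (a < x < b) || (b < x < a).

Lemma betweenC a b : between a b =1 between b a.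
Proof. by move=> x; rewrite /between orbC. Qed.

(** Branches are monotone, and decreasing or increasing according to e; the
    unordered betweenness makes both cases look the same. *)
Lemma between_branch j a b x : (0 < j)%N -> 0 <= a <= 1 -> 0 <= b <= 1 -> Omega x ->
  between (branch j a) (branch j b) x = (quot x == j) && between a b (cfmap x).
Proof.
move=> j0 ha hb hx; case: eqP => [<-|nj].
  have [q0 _ _] := quot_itv hx; have hT := OmegaW (cfmap_Omega hx).
  have ltl c : 0 <= c <= 1 -> (x < branch (quot x) c) =
      if e (quot x) then cfmap x < c else c < cfmap x.
    by move=> hc; rewrite -branch_lt// branch_cfmap.
  have ltr c : 0 <= c <= 1 -> (branch (quot x) c < x) =
      if e (quot x) then c < cfmap x else cfmap x < c.
    by move=> hc; rewrite -branch_lt// branch_cfmap.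
  rewrite /between !ltl// !ltr//; case: (e (quot x)) => //=.
  by rewrite orbC; congr (_ || _); rewrite andbC.
apply/negbTE; apply/negP => bx; apply: nj; apply: quot_eq.
have /andP[a1 a2] := branch_itv j0 ha; have /andP[b1 b2] := branch_itv j0 hb.
have [x1 x2] : j.+1%:R^-1 < x /\ x < j%:R^-1.
  by case/orP: bx => /andP[u1 u2]; split; move: a1 a2 b1 b2 u1 u2;
    move: (branch j a) (branch j b) (_^-1) (_^-1) => ? ? ? ?; lra.
have x0 : 0 < x by move: hx => /OmegaP[].
rewrite -[j%:R]invrK -[j.+1%:R]invrK lef_pV2 ?posrE ?invr_gt0 ?ltr0n// ltW//=.
by rewrite ltf_pV2 ?posrE ?invr_gt0 ?ltr0n.
Qed.

Definition word_point w z : R := foldr branch z w.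

Definition positive_word w := all (fun j => 0 < j)%N w.

Fixpoint starts_with w x : bool :=
  if w is j :: w' then (quot x == j) && starts_with w' (cfmap x) else true.

Lemma word_point_01 w z : positive_word w -> 0 <= z <= 1 -> 0 <= word_point w z <= 1.
Proof.
elim: w => //= j w IH /andP[j0 hw] hz.
by apply: branch_01 => //; exact: IH.
Qed.

Lemma rational_word_point w z : rational z -> rational (word_point w z).
Proof. by move=> rz; elim: w => //= j w IH; exact: rational_branch. Qed.

Lemma word_point_rcons w j z : word_point (rcons w j) z = word_point w (branch j z).
Proof. by rewrite /word_point foldr_rcons. Qed.

Let zero01 : 0 <= (0 : R) <= 1. Proof. by rewrite lexx ler01. Qed.
Let one01 : 0 <= (1 : R) <= 1. Proof. by rewrite lexx ler01. Qed.

(** Cylinders are intervals with rational endpoints. *)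
Lemma starts_with_between w x : positive_word w -> Omega x ->
  starts_with w x = between (word_point w 0) (word_point w 1) x.
Proof.
elim: w x => [|j w IH] x /=.
  by move=> _ /OmegaP[x0 x1 _]; rewrite /between/= x0 x1.
move=> /andP[j0 hw] hx; rewrite between_branch ?word_point_01//.
by rewrite IH//; exact: cfmap_Omega.
Qed.

(** Think of E a b as: two measures agree on the interval between a and b.
    The Euclidean algorithm writes c = p/q as a finite composition of
    branches, with the denominators decreasing.  Hence c is reached from 0
    through endpoints of cylinders only; the points 1/j are reached from 1 by
    crossing the finitely many cylinders of quotient below j.  Crossing
    finitely many cylinders at each step avoids any countable additivity. *)
Lemma cylinders_determine_rationals (E : R -> R -> Prop) :
  (forall a, E a a) -> (forall a b, E a b -> E b a) ->
  (forall a b c, E a b -> E b c -> E a c) ->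
  (forall w, positive_word w -> E (word_point w 0) (word_point w 1)) ->
  forall c, rational c -> 0 <= c <= 1 -> E 0 c.
Proof.
move=> Er Es Et Ew.
have posr w j : positive_word w -> (0 < j)%N -> positive_word (rcons w j).
  by move=> hw j0; rewrite /positive_word all_rcons j0.
have Einv w j : positive_word w -> E (word_point w 0) (word_point w j.+1%:R^-1).
  move=> hw; elim: j => [|j IH]; first by rewrite invr1; exact: Ew.
  apply: Et IH _; have := Ew _ (posr w j.+1 hw isT).
  rewrite !word_point_rcons /branch; case: ifP => _.
    by rewrite subr0 -[j.+2%:R]natr1 addrK; exact: Es.
  by rewrite addr0 natr1.
have Eq : forall q p w, positive_word w -> (0 < q)%N -> (p <= q)%N ->
    E (word_point w 0) (word_point w (p%:R / q%:R)).
  move=> q; have [n] := ubnP q; elim: n q => // n IH q qn p w hw q0 pq.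
  have [->|p0] := posnP p; first by rewrite mul0r; exact: Er.
  have [pq'|] := ltnP p q; last first.
    move=> qp; have -> : p = q by apply/eqP; rewrite eqn_leq pq.
    by rewrite divff ?pnatr_eq0 -?lt0n//; exact: Ew.
  have j0 : (0 < q %/ p)%N by rewrite divn_gt0.
  have pr0 : p%:R != 0 :> R by rewrite pnatr_eq0 -lt0n.
  have qE : q%:R = (q %/ p)%:R * p%:R + (q %% p)%:R :> R.
    by rewrite -natrM -natrD -divn_eq.
  have rp : (q %% p <= p)%N by rewrite ltnW// ltn_pmod.
  pose p' := if e (q %/ p)%N then (p - q %% p)%N else (q %% p)%N.
  have pE : p%:R / q%:R = branch (q %/ p) (p'%:R / p%:R) :> R.
    rewrite -[LHS]invrK invf_div; congr (_^-1); rewrite qE /p'.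
    by case: (e _); rewrite ?natrB// -?natr1; field.
  rewrite pE -word_point_rcons.
  have : E (word_point (rcons w (q %/ p)%N) 0)
           (word_point (rcons w (q %/ p)%N) (p'%:R / p%:R)).
    apply: IH => //; first by rewrite (leq_trans pq')// -ltnS.
      exact: posr.
    by rewrite /p'; case: ifP => _ //; rewrite leq_subr.
  apply: Et; rewrite word_point_rcons /branch; case: ifP => _.
    by rewrite subr0; exact: Einv.
  by rewrite addr0 -(prednK j0); exact: Einv.
move=> c /rationalP[a [b ->]] /andP[c0 c1].
have [->|b0] := posnP b; first by rewrite invr0 mulr0; exact: Er.
have a0 : (0 <= a)%R.
  by move: c0; rewrite pmulr_lge0 ?invr_gt0 ?ltr0n// ler0z.
move: a a0 c1 {c0} => [a|//] _; rewrite ler_pdivrMr ?ltr0n// mul1r.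
by rewrite -pmulrn ler_nat => ab; exact: (Eq b a [::]).
Qed.

End ContinuedFractionMaps.

(** * Normality as equidistribution *)

Section Equidistribution.
Variable R : realType.

Lemma cvg_ext (u v : nat -> R) (l : R) : u =1 v -> v @ \oo --> l -> u @ \oo --> l.
Proof. by move=> uv; rewrite (eq_cvg \oo _ uv). Qed.

Lemma cvg_sub (u v : nat -> R) (a b : R) :
  u @ \oo --> a -> v @ \oo --> b -> (fun N => u N - v N) @ \oo --> a - b.
Proof. exact: cvgB. Qed.

Lemma cvg_seq_cst (c : R) : (fun=> c : R) @ \oo --> c.
Proof. exact: cvg_cst. Qed.

(** Rational thresholds suffice, and they are never hit by the irrational
    remainders. *)
Definition equidistributed (y : nat -> R) (F : R -> R) : Prop :=
  forall c : R, rational c -> 0 <= c <= 1 ->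
    cesaro (fun n => \1(y n < c)) @ \oo --> F c.

Lemma between_indicator (a b x : R) : a <= b -> rational a -> ~ rational x ->
  \1(between a b x) = \1(x < b) - \1(x < a) :> R.
Proof.
move=> ab ra nx; have := irrational_neq nx ra; rewrite /between.
case: (ltgtP x a) => // [xa|ax] _ /=; last by rewrite andbF orbF subr0.
by have xb := lt_le_trans xa ab; rewrite xb (lt_gtF xb) subrr.
Qed.

Variables (e : pred nat) (D : Type) (I : D -> set R) (T : R -> R).
Variables (mu : set R -> \bar R) (F : R -> R) (quot_of : D -> nat).
Hypothesis T_cfmap : forall x, Omega x -> T x = cfmap e x.
Hypothesis I_quot : forall d x, I d x <-> Omega x /\ quot x = quot_of d.
Hypothesis quot_of_gt0 : forall d, (0 < quot_of d)%N.
Hypothesis quot_of_surj : forall j, (0 < j)%N -> exists d, quot_of d = j.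
Hypothesis mu_between : forall a b : R, 0 <= a -> a <= b -> b <= 1 ->
  mu (Omega `&` [set x | between a b x]) = (F b - F a)%:E.
Hypothesis F0 : F 0 = 0.

Lemma iter_cfmap x n : Omega x -> iter n T x = iter n (cfmap e) x /\ Omega (iter n T x).
Proof.
move=> hx; elim: n => //= n [IH ho]; split; first by rewrite T_cfmap// IH.
by rewrite T_cfmap//; exact: cfmap_Omega.
Qed.

Lemma cylinder_starts_with s :
  cylinder T I s = Omega `&` [set x | starts_with e (map quot_of s) x].
Proof.
elim: s => [|d s IH] /=; first by rewrite setIidl.
apply/seteqP; split=> x /=.
  move=> [/I_quot[hx qx]]; rewrite IH/= T_cfmap// => -[_ hs].
  by split=> //; rewrite qx eqxx.
move=> [hx /andP[/eqP qx hs]]; split; first exact/I_quot.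
by rewrite IH /= T_cfmap//; split=> //; exact: cfmap_Omega.
Qed.

Lemma positive_map_quot s : positive_word (map quot_of s).
Proof. by elim: s => //= d s ->; rewrite quot_of_gt0. Qed.

Lemma lift_word w : positive_word w -> exists s, map quot_of s = w.
Proof.
elim: w => [|j w IH] /=; first by exists [::].
by move=> /andP[/quot_of_surj[d dj] /IH[s sw]]; exists (d :: s); rewrite /= dj sw.
Qed.

Lemma cylinder_between s a b : a <= b ->
  (a = word_point e (map quot_of s) 0 /\ b = word_point e (map quot_of s) 1) \/
  (b = word_point e (map quot_of s) 0 /\ a = word_point e (map quot_of s) 1) ->
  cylinder T I s = Omega `&` [set x | between a b x].
Proof.
move=> ab hab; rewrite cylinder_starts_with.
apply/seteqP; split=> x /= [hx]; rewrite starts_with_between ?positive_map_quot//;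
  case: hab => -[-> ->] //; by rewrite betweenC.
Qed.

Section Orbit.
Variables (x : R) (hx : Omega x).
Let y n := iter n T x.

Lemma cesaro_cylinder s a b : a <= b -> rational a ->
  cylinder T I s = Omega `&` [set x | between a b x] ->
  (fun N => (visit_count T x (cylinder T I s) N)%:R / N%:R : R) =
  (fun N => cesaro (fun n => \1(y n < b)) N - cesaro (fun n => \1(y n < a)) N).
Proof.
move=> ab ra ->; apply/funext => N.
rewrite /visit_count -sum1_card big_mkcond/= natr_sum /cesaro -mulrBl -sumrB.
congr (_ / _); apply: eq_bigr => i _.
have [_ hy] := iter_cfmap i hx; have /OmegaP[_ _ ny] := hy.
rewrite -between_indicator// (_ : (_ \in _) = between a b (y i)); first by case: between.
rewrite unfold_in /=; apply/idP/idP => [/set_mem[_ //]|h].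
by apply/mem_set; split.
Qed.

(** Cylinders are intervals, so equidistribution gives normality.  Conversely
    cylinders_determine_rationals applies to the relation: the defects of the
    frequencies at a and b have the same limiting behaviour. *)
Lemma normal_equidistributed :
  normal_point T I mu x <-> equidistributed y F.
Proof.
have p01 w (c : R) : positive_word w -> 0 <= c <= 1 -> 0 <= word_point e w c <= 1.
  exact: word_point_01.
have z01 : 0 <= (0 : R) <= 1 by rewrite lexx ler01.
have o01 : 0 <= (1 : R) <= 1 by rewrite lexx ler01.
have r0 : rational (0 : R) by exact: (rational_nat R 0).
have r1 : rational (1 : R) by exact: (rational_nat R 1).
split=> [hn|he].
  pose E a b := (fun N => (cesaro (fun n => \1(y n < a)) N - F a) -
    (cesaro (fun n => \1(y n < b)) N - F b)) @ \oo --> (0 : R).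
  have Er a : E a a.
    have h := cvg_seq_cst (c := 0).
    by rewrite /E; apply: cvg_ext h => N; rewrite /= subrr.
  have Es a b : E a b -> E b a.
    move=> /cvgN; rewrite oppr0 => h; rewrite /E; apply: cvg_ext h => N.
    by rewrite -[LHS]opprB.
  have Et a b c : E a b -> E b c -> E a c.
    move=> h1 /Es h2; have := cvg_sub h1 h2; rewrite subr0 => h.
    by apply: cvg_ext h => N; ring.
  have Ew w : positive_word w -> E (word_point e w 0) (word_point e w 1).
    move=> hw; have [s sw] := lift_word hw.
    have key a b : a <= b -> rational a -> 0 <= a -> b <= 1 ->
        cylinder T I s = Omega `&` [set x | between a b x] -> E b a.
      move=> ab ra a0 b1 cE; have mE := mu_between a0 ab b1.
      have cv : (fun N => cesaro (fun n => \1(y n < b)) N -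
          cesaro (fun n => \1(y n < a)) N) @ \oo --> F b - F a.
        rewrite -(cesaro_cylinder ab ra cE).
        have [[z hz]|ns] := pselect (admissible T I s).
          by apply: (@fine_cvg _ _ _ _ (fun N => _%:E)); rewrite -mE -cE; apply: hn; exists z.
        (* an empty cylinder has measure zero and is never visited *)
        have c0 : cylinder T I s = set0.
          by apply/seteqP; split=> // z hz; apply: ns; exists z.
        have -> : F b - F a = 0.
          apply: EFin_inj; rewrite -mE -cE c0 -[RHS]/(0%:E) -(subrr (F 0)).
          rewrite -mu_between//; congr mu; apply/seteqP; split=> // z [_ /=].
          by rewrite /between orbb => /andP[z0 /lt_gtF]; rewrite z0.
        have h := cvg_seq_cst (c := 0).
        rewrite c0; apply: cvg_ext h => N.
        rewrite /visit_count eq_card0 ?mul0r// => i.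
        by rewrite !inE; apply/negbTE/negP => /set_mem.
      have := cvg_sub cv (cvg_seq_cst (c := F b - F a)); rewrite subrr => h; apply: cvg_ext h => N.
      by ring.
    have /andP[a0 a1] := p01 w 0 hw z01; have /andP[b0 b1] := p01 w 1 hw o01.
    have ra := rational_word_point e w r0; have rb := rational_word_point e w r1.
    have /orP[ab|ba] := le_total (word_point e w (0 : R)) (word_point e w 1).
      by apply: Es; apply: key => //; apply: cylinder_between => //; rewrite sw; left; split.
    by apply: (key _ _ ba) => //; apply: cylinder_between ba _; rewrite sw; right; split.
  move=> c rc c01; have := cylinders_determine_rationals Er Es Et Ew rc c01.
  rewrite /E F0 => h; have := cvg_sub (cvg_seq_cst (c := F c)) h; rewrite subr0 => {}h.
  apply: cvg_ext h => N.
  have -> : cesaro (fun n => \1(y n < 0) : R) N = 0.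
    rewrite /cesaro big1 ?mul0r// => i _.
    by have [_ /OmegaP[y0 _ _]] := iter_cfmap i hx; rewrite /y lt_gtF.
  by ring.
move=> s _; have hw := positive_map_quot s.
have /andP[a0 a1] := p01 _ 0 hw z01; have /andP[b0 b1] := p01 _ 1 hw o01.
have ra := rational_word_point e (map quot_of s) r0.
have rb := rational_word_point e (map quot_of s) r1.
have key a b : a <= b -> rational a -> rational b -> 0 <= a -> b <= 1 ->
    cylinder T I s = Omega `&` [set x | between a b x] ->
    (((visit_count T x (cylinder T I s) N)%:R / N%:R : R)%:E)
      @[N --> \oo] --> mu (cylinder T I s).
  move=> ab qa qb ha hb cE; rewrite [in X in _ --> X]cE mu_between//.
  have uE := cesaro_cylinder ab qa cE.
  apply: cvg_EFin; first exact: nearW.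
  rewrite (_ : _ \o _ = fun N => (visit_count T x (cylinder T I s) N)%:R / N%:R)//.
  rewrite uE; apply: cvg_sub; apply: he => //; first by rewrite (le_trans ha ab) hb.
  by rewrite ha (le_trans ab hb).
have /orP[ab|ba] := le_total (word_point e (map quot_of s) (0 : R)) (word_point e (map quot_of s) 1).
  by apply: (key _ _ ab) => //; apply: cylinder_between => //; left; split.
by apply: (key _ _ ba) => //; apply: cylinder_between ba _; right; split.
Qed.

End Orbit.
End Equidistribution.

(** * Distribution functions of the two invariant measures *)

Section Densities.
Variable R : realType.
Implicit Types (f F : R -> R) (a b c x : R).
Let leb := (@lebesgue_measure R).

Lemma is_derive_ln_affine p q x : 0 < p + q * x ->
  is_derive x 1 (fun c => ln (p + q * c)) (q / (p + q * x)).
Proof.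
move=> h; have dl := is_derive1_ln h.
have da : is_derive x 1 (fun c => p + q * c) q.
  have dq := is_deriveD (is_derive_cst p x 1) (is_deriveZ q (is_derive_id x 1)).
  by apply: (is_derive_eq dq); rewrite add0r -[LHS]/(q * 1) mulr1.
rewrite mulrC; exact: (is_derive1_comp (f := @ln R) (g := fun c => p + q * c)).
Qed.

(** The rationals are negligible, so this is the fundamental theorem of
    calculus. *)
Lemma integral_irrational_itv f F a b : 0 <= a -> a <= b -> b <= 1 ->
  (forall x, 0 <= x <= 1 -> is_derive x 1 F (f x)) ->
  (forall x, 0 <= x <= 1 -> {for x, continuous f}) ->
  (forall x, 0 <= x <= 1 -> 0 <= f x) ->
  (\int[leb]_(x in Omega `&` [set x | between a b x]) (f x)%:E = (F b - F a)%:E)%E.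
Proof.
move=> a0 ab b1 dF cf f0.
have [aEb|] := eqVneq a b.
  rewrite aEb subrr (_ : _ `&` _ = set0) ?integral_set0//.
  apply/seteqP; split=> // x [_ /=]; rewrite /between orbb => /andP[h /lt_gtF].
  by rewrite h.
move=> nab; have {}ab : a < b by rewrite lt_neqAle nab.
have in01 x : a <= x <= b -> 0 <= x <= 1.
  by move=> /andP[ax xb]; rewrite (le_trans a0 ax) (le_trans xb b1).
have cN : countable (@rational R).
  exact: sub_countable (card_image_le _ _) (countableP _).
have -> : Omega `&` [set x | between a b x] = `]a, b[%classic `\` rational.
  apply/seteqP; split=> x /=; rewrite in_itv/=.
    move=> [/OmegaP[_ _ nx] /orP[//|/andP[bx xa]]].
    by move: (lt_trans bx xa); rewrite lt_gtF.
  move=> [/andP[ax xb] nx]; split; last by rewrite /between ax xb.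
  by apply/OmegaP; split; [exact: le_lt_trans ax|exact: lt_le_trans b1|].
have cW : {within `[a, b], continuous f}.
  apply: continuous_in_subspaceT => x; rewrite inE/= in_itv/= => /in01.
  exact: cf.
have mf : measurable_fun `]a, b[ (EFin \o f).
  apply: (@measurable_funS _ _ _ _ `[a, b]%classic) => //.
    exact: subset_itv_oo_cc.
  by apply/measurable_EFinP; exact: subspace_continuous_measurable_fun.
rewrite -ge0_negligible_integral//.
- rewrite -(integral_itv_bndoo true false)//.
  rewrite (continuous_FTC2 (F := F))// => [|x].
    have cF x : 0 <= x <= 1 -> {for x, continuous F}.
      move=> /dF d; apply/differentiable_continuous/derivable1_diffP.
      by case: d.
    split=> [x|  |].
    + by rewrite in_itv/= => /andP[/ltW ax /ltW xb]; case: (dF x _) => //; rewrite in01 ?ax.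
    + by apply: cvg_at_right_filter; apply: cF; rewrite in01// lexx ltW.
    + by apply: cvg_at_left_filter; apply: cF; rewrite in01// lexx ltW.
  rewrite in_itv/= => /andP[/ltW ax /ltW xb].
  have [_ d] : is_derive x 1 F (f x) by apply: dF; rewrite in01 ?ax.
  by rewrite derive1E.
- exact: countable_measurable.
- move=> x /=; rewrite in_itv/= => /andP[/ltW ax /ltW xb].
  by rewrite lee_fin f0// in01// ax.
- exact: countable_lebesgue_measure0.
Qed.

Definition rcf_cdf c := ln (1 + c) / ln 2.

Lemma mu_RCF_between a b : 0 <= a -> a <= b -> b <= 1 ->
  mu_RCF (Omega `&` [set x | between a b x]) = (rcf_cdf b - rcf_cdf a)%:E.
Proof.
move=> a0 ab b1; rewrite /mu_RCF.
have dF x : 0 <= x <= 1 -> is_derive x 1 (fun c => ln (1 + 1 * c)) ((1 + x)^-1).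
  move=> /andP[x0 _]; have x1 : 0 < 1 + 1 * x by lra.
  by have := is_derive_ln_affine x1; rewrite !mul1r.
rewrite (integral_irrational_itv a0 ab b1 dF).
- by rewrite -EFinM /rcf_cdf !mul1r; congr EFin; ring.
- move=> x /andP[x0 _]; apply: continuousV; first by rewrite gt_eqF//; lra.
  by apply: continuousD; [exact: cvg_cst|exact: cvg_id].
- by move=> x /andP[x0 _]; rewrite invr_ge0; lra.
Qed.

Local Notation G := (golden R).

Lemma golden_sqr : G * G = G + 1.
Proof.
have := @sqr_sqrtr R 5; rewrite /golden expr2 => /(_ ltac:(by lra)) h.
by field: h.
Qed.

Lemma golden_itv : 3 / 2 < G < 5 / 3.
Proof.
have := golden_sqr; have : 0 <= Num.sqrt (5 : R) by [].
rewrite /golden; set s := Num.sqrt 5 => s0 h.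
have h2 : s * s = 5 by move: h; lra.
by apply/andP; split; nra.
Qed.

Definition ocf_cdf c := (ln (1 + G * c) - ln (1 - (2 - G) * c)) / (3 * ln G).

Lemma mu_OCF_between a b : 0 <= a -> a <= b -> b <= 1 ->
  mu_OCF (Omega `&` [set x | between a b x]) = (ocf_cdf b - ocf_cdf a)%:E.
Proof.
move=> a0 ab b1; rewrite /mu_OCF.
have /andP[G1 G2] := golden_itv; have GG := golden_sqr.
have dF x : 0 <= x <= 1 ->
    is_derive x 1 (fun c => ln (1 + G * c) - ln (1 + (G - 2) * c))
      ((G + x - 1)^-1 + (G + 1 - x)^-1).
  move=> /andP[x0 x1]; have h1 : 0 < 1 + G * x by nra.
  have h2 : 0 < 1 + (G - 2) * x by nra.
  have d := is_deriveB (is_derive_ln_affine h1) (is_derive_ln_affine h2).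
  apply: (is_derive_eq d).
  have h3 : G + x - 1 != 0 by rewrite gt_eqF//; lra.
  have h4 : G + 1 - x != 0 by rewrite gt_eqF//; lra.
  have e1 : 1 + G * x = G * (G + x - 1) by rewrite !mulrDr GG; ring.
  have e2 : 1 + (G - 2) * x = (2 - G) * (G + 1 - x).
    by rewrite !mulrBl !mulrBr !mulrDr GG; ring.
  rewrite e1 e2; field; rewrite h3 h4 /=.
  by apply/andP; split; rewrite gt_eqF//; lra.
rewrite (integral_irrational_itv a0 ab b1 dF).
- rewrite -EFinM /ocf_cdf; congr EFin.
  have E c : 1 - (2 - G) * c = 1 + (G - 2) * c by ring.
  by rewrite !E; ring.
- move=> x /andP[x0 x1]; apply: continuousD.
    apply: continuousV; first by rewrite gt_eqF//; lra.
    by apply: continuousB; [apply: continuousD; [exact: cvg_cst|exact: cvg_id]|exact: cvg_cst].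
  apply: continuousV; first by rewrite gt_eqF//; lra.
  by apply: continuousB; [exact: cvg_cst|exact: cvg_id].
- by move=> x /andP[x0 x1]; apply: addr_ge0; rewrite invr_ge0; lra.
Qed.

End Densities.

(** * Change of clock *)

Section TimeChange.
Variable R : realType.
Variables (u v : nat -> R) (sigma : nat -> nat) (M : R).
Hypothesis sum_sigma : forall n, \sum_(i < n) v i = \sum_(j < sigma n) u j.
Hypothesis sigma_le : forall n, (sigma n <= sigma n.+1 <= sigma n + 2)%N.
Hypothesis sigma0 : sigma 0 = 0%N.
Hypothesis sigma_ge : forall n, (n <= (sigma n).*2)%N.
Hypothesis u_bound : forall j, `|u j| <= M.

Lemma sigma_ub n : (sigma n <= n.*2)%N.
Proof.
elim: n => [|n IH]; first by rewrite sigma0.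
by have /andP[_ h] := sigma_le n; lia.
Qed.

Lemma sigma_bracket k : exists n, (sigma n <= k <= (sigma n).+1)%N.
Proof.
have ex : exists m, (k < sigma m)%N.
  by exists (k.+1).*2; have := sigma_ge (k.+1).*2; lia.
case: (ex_minnP ex) => -[|n] kn hmin; first by rewrite sigma0 in kn.
exists n; have nk : (sigma n <= k)%N.
  by rewrite leqNgt; apply/negP => /hmin; rewrite ltnn.
by have /andP[_ h] := sigma_le n; lia.
Qed.

Lemma cesaro_cvg0P (w : nat -> R) :
  cesaro w @ \oo --> (0 : R) <->
  forall eps : R, 0 < eps -> exists K, forall N, (K <= N)%N ->
    `|\sum_(i < N) w i| <= eps * N%:R.
Proof.
split=> [h eps e0|h].
  have /cvgr0_norm_le/(_ _ e0)[K _ hK] := h.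
  exists K.+1 => N KN; have := hK N (ltnW KN).
  by rewrite /cesaro normrM normfV normr_nat ler_pdivrMr// ltr0n (leq_trans _ KN).
apply/cvgr0Pnorm_le => eps e0; have [K hK] := h _ e0.
exists K.+1 => // N /= KN; have := hK N (ltnW KN).
by rewrite /cesaro normrM normfV normr_nat ler_pdivrMr// ltr0n (leq_trans _ KN).
Qed.

(** The partial sums of v are those of u at the times sigma n.  Since
    sigma n is between n/2 and 2n and advances by at most 2, averages to zero
    are the same for both. *)
Lemma cesaro_time_change :
  cesaro u @ \oo --> (0 : R) <-> cesaro v @ \oo --> (0 : R).
Proof.
split=> /cesaro_cvg0P h; apply/cesaro_cvg0P => eps e0.
  have [K hK] := h (eps / 2) ltac:(by rewrite divr_gt0).
  exists K.*2 => N KN; rewrite sum_sigma.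
  have KS : (K <= sigma N)%N by have := sigma_ge N; lia.
  apply: (le_trans (hK _ KS)); rewrite -mulrA ler_wpM2l ?(ltW e0)//.
  have := sigma_ub N; rewrite -(ler_nat R) -muln2 natrM; lra.
have [K hK] := h (eps / 4) ltac:(by rewrite divr_gt0).
have [L hL] : exists L : nat, M <= eps / 2 * L%:R.
  have e2 : 0 < eps / 2 by rewrite divr_gt0.
  have M0 : 0 <= M by rewrite (le_trans (normr_ge0 (u 0%N))).
  exists (Num.bound (M / (eps / 2))); rewrite -ler_pdivrMl//.
  by rewrite mulrC; apply/ltW/archi_boundP/divr_ge0 => //; exact: ltW.
exists (K.*2 + L).+2 => N KN; have [n /andP[n1 n2]] := sigma_bracket N.
have Kn : (K <= n)%N by have := sigma_ub n; lia.
have nN : (n <= N.*2)%N by have := sigma_ge n; lia.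
have hn := hK _ Kn; rewrite sum_sigma in hn.
have hN : `|\sum_(i < N) u i| <= `|\sum_(j < sigma n) u j| + M.
  have [->|/eqP nn] := eqVneq N (sigma n).
    by rewrite lerDl (le_trans (normr_ge0 (u 0%N))).
  have -> : N = (sigma n).+1 by lia.
  by rewrite big_ord_recr/=; apply: (le_trans (ler_normD _ _)); rewrite lerD2l.
apply: (le_trans hN).
have h1 : eps / 4 * n%:R <= eps / 4 * (N.*2)%:R.
  by rewrite ler_wpM2l ?ler_nat// divr_ge0// ltW.
have h2 : eps / 2 * L%:R <= eps / 2 * N%:R.
  by rewrite ler_wpM2l ?divr_ge0 ?ler_nat//; [exact: ltW|lia].
by move: h1; rewrite -muln2 natrM; lra.
Qed.

End TimeChange.

(** * The transducer from regular to odd continued fractions *)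

Section Transducer.
Variable R : realType.
Implicit Types (t z c : R) (j a n : nat).

Notation gauss := (@cfmap R pred0).
Notation odd_gauss := (@cfmap R (fun j => ~~ odd j)).

Inductive phase := Direct | Mirror | Wait.

Definition next_phase (s : phase) a : phase :=
  match s with
  | Direct => if odd a then Direct else Mirror
  | Mirror => if a == 1%N then Wait else if odd a then Mirror else Direct
  | Wait => if odd a then Mirror else Direct
  end.

(** The next OCF remainder to be emitted when the RCF remainder is t.  In
    phase Wait the point t / (1 + t) has been emitted already. *)
Definition pending (s : phase) t : R :=
  match s with
  | Direct => t
  | Mirror => 1 - t
  | Wait => odd_gauss (t / (1 + t))
  end.

(** If t = 1 / (b + z) with b at least 2, then 1 - t has OCF digit (1, 1) and
    image t / (1 - t) = 1 / (b - 1 + z).  If t = 1 / (1 + z), then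
    1 - t = z / (1 + z), whose digit depends on the next RCF digit. *)
Definition emitted (s : phase) t : seq R :=
  match s with
  | Direct => [:: t]
  | Mirror => if quot t == 1%N then [:: 1 - t] else [:: 1 - t; t / (1 - t)]
  | Wait => [::]
  end.

Lemma odd_gauss_inv j z : (0 < j)%N -> Omega z ->
  odd_gauss (j%:R + z)^-1 = if odd j then z else 1 - z.
Proof.
move=> j0 hz; have := quot_branch pred0 j0 hz; rewrite /branch/= => qE.
rewrite /cfmap qE invrK addrAC subrr add0r.
by case: (odd j).
Qed.

Lemma gauss_inv t : Omega t -> t = ((quot t)%:R + gauss t)^-1.
Proof. by move=> ht; rewrite -[LHS](branch_cfmap pred0 ht). Qed.

Lemma mirror_ratio t : Omega t -> quot t != 1%N ->
  t / (1 - t) = (((quot t).-1)%:R + gauss t)^-1.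
Proof.
move=> ht q1; have [q0 _ _] := quot_itv ht; have /OmegaP[t0 t1 _] := ht.
have -> : ((quot t).-1)%:R = (quot t)%:R - 1 :> R by rewrite -subn1 natrB.
have -> : (quot t)%:R - 1 + gauss t = t^-1 - 1.
  by rewrite {3}(gauss_inv ht) invrK; ring.
have n1 : t != 0 by rewrite gt_eqF.
have -> : t^-1 - 1 = (1 - t) / t by field.
by rewrite invf_div.
Qed.

Lemma mirror_one t : Omega t -> quot t = 1%N ->
  1 - t = gauss t / (1 + gauss t).
Proof.
move=> ht q1; have := gauss_inv ht; rewrite q1 => tE.
have /OmegaP[z0 _ _] := cfmap_Omega pred0 ht.
have n0 : 1 + gauss t != 0 by rewrite gt_eqF//; lra.
by rewrite {1}tE; field.
Qed.

Lemma wait_ratio t : Omega t -> t / (1 + t) = (((quot t).+1)%:R + gauss t)^-1.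
Proof.
move=> ht; have /OmegaP[t0 t1 _] := ht.
have -> : ((quot t).+1)%:R + gauss t = t^-1 + 1.
  by rewrite {3}(gauss_inv ht) invrK -natr1; ring.
have n1 : t != 0 by rewrite gt_eqF.
have -> : t^-1 + 1 = (1 + t) / t by field.
by rewrite invf_div.
Qed.

Lemma odd_gauss_mirror t : Omega t -> quot t != 1%N ->
  odd_gauss (1 - t) = t / (1 - t).
Proof.
move=> ht q1; have [q0 _ _] := quot_itv ht; have /OmegaP[t0 t1 _] := ht.
have hz : Omega (t / (1 - t)).
  rewrite mirror_ratio//.
  have := @branch_Omega R pred0 (quot t).-1 _ _ (cfmap_Omega pred0 ht).
  by apply; move: (quot t) q0 q1 => [|[|]].
have tE : 1 - t = (1%:R + t / (1 - t))^-1.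
  have n0 : 1 - t != 0 by rewrite gt_eqF//; lra.
  by field; rewrite n0 addrNK oner_neq0.
by rewrite {1}tE odd_gauss_inv.
Qed.

Lemma emitted_traject s t : Omega t ->
  emitted s t = traject odd_gauss (pending s t) (size (emitted s t)).
Proof.
by move=> ht; case: s => //=; case: eqP => //= /eqP q1; rewrite odd_gauss_mirror.
Qed.

(** The invariant of the transducer: emitting and then reading the RCF digit
    agrees with moving along the OCF orbit. *)
Lemma pending_step s t : Omega t ->
  iter (size (emitted s t)) odd_gauss (pending s t) =
  pending (next_phase s (quot t)) (gauss t).
Proof.
move=> ht; have [q0 _ _] := quot_itv ht; have hz := cfmap_Omega pred0 ht.
case: s => /=.
- by rewrite {1}(gauss_inv ht) odd_gauss_inv//; case: (odd _).
- case: eqP => [q1|/eqP q1] /=; first by rewrite mirror_one.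
  rewrite odd_gauss_mirror// mirror_ratio// odd_gauss_inv//; last first.
    by move: (quot t) q0 q1 => [|[|]].
  by case: (quot t) q0 => //= a _; rewrite if_neg; case: (odd a).
- by rewrite wait_ratio// odd_gauss_inv//=; case: (odd _).
Qed.

Variables (x : R) (hx : Omega x).

Definition rcf_orbit n : R := iter n gauss x.
Definition ocf_orbit n : R := iter n odd_gauss x.

Fixpoint phase_at n : phase :=
  if n is n'.+1 then next_phase (phase_at n') (quot (rcf_orbit n')) else Direct.

Definition emitted_at n := emitted (phase_at n) (rcf_orbit n).

Definition clock n : nat := \sum_(i < n) size (emitted_at i).

Lemma rcf_orbit_Omega n : Omega (rcf_orbit n).
Proof. by elim: n => //= n IH; exact: cfmap_Omega. Qed.

Lemma ocf_orbit_clock n : ocf_orbit (clock n) = pending (phase_at n) (rcf_orbit n).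
Proof.
elim: n => [|n IH]; first by rewrite /clock big_ord0.
rewrite /clock big_ord_recr/= -/(clock n) addnC /ocf_orbit iterD -/(ocf_orbit _) IH.
by rewrite pending_step//; exact: rcf_orbit_Omega.
Qed.

Lemma sum_emitted (h : R -> R) n :
  \sum_(i < n) (\sum_(y <- emitted_at i) h y) = \sum_(k < clock n) h (ocf_orbit k).
Proof.
elim: n => [|n IH]; first by rewrite /clock !big_ord0.
rewrite big_ord_recr/= IH [clock n.+1]/clock big_ord_recr/= -/(clock n).
rewrite big_split_ord/=; congr (_ + _).
rewrite /emitted_at [in LHS]emitted_traject; last exact: rcf_orbit_Omega.
rewrite -ocf_orbit_clock; move: (size _) => m.
rewrite (big_nth x) size_traject big_mkord; apply: eq_bigr => i _.
rewrite (set_nth_default (ocf_orbit (clock n))) ?size_traject//.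
by rewrite nth_traject// /ocf_orbit -iterD addnC.
Qed.

Lemma clock_le n : (clock n <= clock n.+1 <= clock n + 2)%N.
Proof.
rewrite [clock n.+1]/clock big_ord_recr/= -/(clock n) leq_addr leq_add2l /emitted_at.
by case: (phase_at n) => //=; case: ifP.
Qed.

(** A step in phase Wait, which emits nothing, always follows a step in phase
    Mirror, which emits. *)
Lemma clock_ge n : (n <= (clock n).*2)%N.
Proof.
suff : (if phase_at n is Wait then n.+1 <= (clock n).*2 else n <= (clock n).*2)%N.
  by case: (phase_at n) => //; exact: ltnW.
elim: n => [|n IH]; first by rewrite /clock big_ord0.
rewrite [clock n.+1]/clock big_ord_recr/= -/(clock n) /emitted_at.
move: IH; case: (phase_at n) => /=.
- by case: (odd _) => h; lia.
- by case: (quot _ == _) => /=; [|case: (odd _)] => /= h; lia.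
- by case: (odd _) => h; lia.
Qed.

(** A frequency along the OCF orbit, read on the RCF clock. *)
Lemma ocf_frequency (h : R -> R) (l : R) : (forall y, 0 <= h y <= 1) ->
  cesaro (fun k => h (ocf_orbit k)) @ \oo --> l <->
  cesaro (fun n => \sum_(y <- emitted_at n) (h y - l)) @ \oo --> (0 : R).
Proof.
move=> h01.
rewrite -(@cesaro_time_change R (fun k => h (ocf_orbit k) - l) _ clock (1 + `|l|)) //.
- have E N : (0 < N)%N -> cesaro (fun k => h (ocf_orbit k) - l) N = cesaro (fun k => h (ocf_orbit k)) N - l.
    move=> N0; rewrite /cesaro sumrB mulrBl sumr_const card_ord -[l *+ N]mulr_natr mulfK//.
    by rewrite pnatr_eq0 -lt0n.
  split=> [/cvg_sub/(_ (cvg_seq_cst (c := l)))|].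
    rewrite subrr; apply: cvg_trans; apply: near_eq_cvg.
    by exists 1%N => // N /= N0; rewrite E.
  move=> /cvgD/(_ (cvg_seq_cst (c := l))); rewrite add0r; apply: cvg_trans; apply: near_eq_cvg.
  by exists 1%N => // N /= N0; rewrite -[LHS]/(_ + _) E// subrK.
- by move=> n; rewrite (sum_emitted (fun y => h y - l)).
- exact: clock_le.
- by rewrite /clock big_ord0.
- exact: clock_ge.
- move=> j; apply: (le_trans (ler_normB _ _)); rewrite lerD2r.
  by have /andP[h0 h1] := h01 (ocf_orbit j); rewrite ger0_norm.
Qed.

End Transducer.

(** * The digit operators and the contraction by the parity sign *)

Section ParityOperator.
Variable R : realType.
Implicit Types (f : R -> R) (e : nat -> R) (r s t : R) (a M : nat).

(** If r = q_(n-1) / q_n for a block of n digits, this is the proportion of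
    its cylinder, in length, where the next digit is a; the new ratio is then
    1 / (a + r). *)
Definition digit_weight a r : R := (1 + r) / ((a%:R + r) * (a%:R + r + 1)).

Definition parity_sign a : R := if odd a then 1 else -1.

Definition digit_operator M e f r : R :=
  \sum_(a < M) e a.+1 * digit_weight a.+1 r * f (a.+1%:R + r)^-1.

(** The Lipschitz constant 3 is large enough to be preserved by digit
    operators and small enough for f to have cancellation between the digits 1
    and 2: the points 1/(1+r) and 1/(2+r) are at distance at most 1/2, so f
    cannot take nearly opposite extreme values at them. *)
Definition tame (S : R) f : Prop :=
  (forall r, 0 <= r <= 1 -> `|f r| <= S) /\
  (forall r s, 0 <= r <= 1 -> 0 <= s <= 1 -> `|f r - f s| <= 3 * S * `|r - s|).

Let pos a : 1 <= a.+1%:R :> R. Proof. by rewrite ler1n. Qed.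

Lemma digit_weight_ge0 a r : 0 <= r -> 0 <= digit_weight a.+1 r.
Proof.
by move=> r0; have x1 := pos a; rewrite /digit_weight divr_ge0 ?mulr_ge0//; lra.
Qed.

Lemma sum_digit_weight M r : 0 <= r -> \sum_(a < M) digit_weight a.+1 r = M%:R / (M%:R + 1 + r).
Proof.
move=> r0; elim: M => [|M IH]; first by rewrite big_ord0 mul0r.
rewrite big_ord_recr/= IH /digit_weight -[M.+1%:R]natr1.
have : 0 <= M%:R :> R by []. move: (M%:R) => x x0.
by field; apply/andP; split; rewrite gt_eqF//; lra.
Qed.

Lemma sum_digit_weight_le1 M r : 0 <= r -> \sum_(a < M) digit_weight a.+1 r <= 1.
Proof.
move=> r0; rewrite sum_digit_weight// ler_pdivrMr; have : 0 <= M%:R :> R by [].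
  by lra.
by lra.
Qed.

Lemma inv_diff a r s : 0 <= r -> 0 <= s ->
  `|(a.+1%:R + r)^-1 - (a.+1%:R + s)^-1| =
  `|r - s| / ((a.+1%:R + r) * (a.+1%:R + s)).
Proof.
move=> r0 s0; move: (pos a); move: (a.+1%:R) => x x1.
have h1 : 0 < x + r by lra. have h2 : 0 < x + s by lra.
have -> : (x + r)^-1 - (x + s)^-1 = (s - r) / ((x + r) * (x + s)).
  by field; apply/andP; split; rewrite gt_eqF.
by rewrite normrM distrC [X in _ * X]ger0_norm// invr_ge0 mulr_ge0 ?ltW.
Qed.

(** The bound is the telescoping quantity 1/a - 1/(a+1), whose sum over
    the digits is at most 1 uniformly in the truncation M. *)
Lemma digit_weight_lip a r s : 0 <= r <= 1 -> 0 <= s <= 1 ->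
  `|digit_weight a.+1 r - digit_weight a.+1 s| <=
  (a.+1%:R^-1 - a.+2%:R^-1) * `|r - s|.
Proof.
move=> /andP[r0 r1] /andP[s0 s1]; rewrite -[a.+2%:R]natr1 /digit_weight.
move: (pos a); move: (a.+1%:R) => x x1.
pose A := (x + r) * (x + r + 1); pose C := (x + s) * (x + s + 1).
have A0 : 0 < A by rewrite mulr_gt0//; lra.
have C0 : 0 < C by rewrite mulr_gt0//; lra.
have AC0 : 0 < A * C by exact: mulr_gt0.
have -> : (1 + r) / ((x + r) * (x + r + 1)) - (1 + s) / ((x + s) * (x + s + 1)) =
    (r - s) * ((x * (x - 1) - (1 + r) * (1 + s)) / (A * C)).
  rewrite /A /C; field.
  by do ?[apply/andP; split]; rewrite gt_eqF//; lra.
have AE : x * (x + 1) <= A by rewrite ler_pM//; lra.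
have num : `|x * (x - 1) - (1 + r) * (1 + s)| <= C.
  have h1 : x * (x - 1) <= C by rewrite ler_pM//; lra.
  have h2 : (1 + r) * (1 + s) <= C by rewrite mulrC ler_pM//; lra.
  have h3 : 0 <= x * (x - 1) by rewrite mulr_ge0//; lra.
  have h4 : 0 <= (1 + r) * (1 + s) by rewrite mulr_ge0//; lra.
  by rewrite ler_norml; apply/andP; split; lra.
have -> : x^-1 - (x + 1)^-1 = (x * (x + 1))^-1.
  by field; apply/andP; split; rewrite gt_eqF//; lra.
rewrite normrM mulrC ler_wpM2r// normrM normfV [X in _ / X]gtr0_norm//.
rewrite ler_pdivrMr//.
apply: (le_trans num); rewrite mulrA ler_peMl ?(ltW C0)//.
by rewrite ler_pdivlMl ?mulr1// mulr_gt0//; lra.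
Qed.

Lemma sum_inv_diff M : \sum_(a < M) (a.+1%:R^-1 - a.+2%:R^-1) <= 1 :> R.
Proof.
suff -> : \sum_(a < M) (a.+1%:R^-1 - a.+2%:R^-1) = 1 - M.+1%:R^-1 :> R.
  by rewrite gerBl invr_ge0.
elim: M => [|M IH]; first by rewrite big_ord0 invr1 subrr.
by rewrite big_ord_recr/= IH addrA subrK.
Qed.

(** The maps r |-> 1/(a+r) contract on average: only the digit 1, of
    probability at most 1/2, has derivative above 1/4 in modulus. *)
Lemma sum_contraction M s r : 0 <= r -> 0 <= s <= 1 ->
  \sum_(a < M) digit_weight a.+1 s / ((a.+1%:R + r) * (a.+1%:R + s)) <= 5 / 8.
Proof.
move=> r0 /andP[s0 s1]; case: M => [|M]; first by rewrite big_ord0; lra.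
have := sum_digit_weight_le1 M.+1 s0; rewrite !big_ord_recl/=.
set W := \sum_(i < M) _ => hW.
have p1 : digit_weight 1 s = (2 + s)^-1.
  by rewrite /digit_weight; field; apply/andP; split; rewrite gt_eqF//; lra.
have tail : \sum_(i < M) digit_weight (bump 0 i).+1 s /
    (((bump 0 i).+1%:R + r) * ((bump 0 i).+1%:R + s)) <= W / 4.
  rewrite /W mulr_suml; apply: ler_sum => i _; rewrite /bump/= add1n.
  have x2 : 2 <= i.+2%:R :> R by rewrite ler_nat.
  apply: ler_wpM2l; first exact: digit_weight_ge0.
  rewrite lef_pV2 ?posrE ?mulr_gt0//; [nra|lra|lra].
have first_le : digit_weight 1 s / ((1 + r) * (1 + s)) <= digit_weight 1 s / (1 + s).
  apply: ler_wpM2l; first exact: digit_weight_ge0.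
  by rewrite lef_pV2 ?posrE ?mulr_gt0//; [nra|lra|lra|lra].
have q1 : digit_weight 1 s <= 1 / 2 by rewrite p1 ler_pdivlMr//; rewrite mulrC ler_pdivrMr; lra.
have q2 : digit_weight 1 s / (1 + s) <= digit_weight 1 s.
  by rewrite ler_pdivrMr; have := digit_weight_ge0 0 s0; nra.
apply: (le_trans (lerD first_le tail)); lra.
Qed.

Section Bounds.
Variables (M : nat) (e : nat -> R) (f : R -> R) (S : R).
Hypotheses (he : forall a, `|e a| <= 1) (hf : tame S f).

Let S0 : 0 <= S.
Proof. by have := hf.1 0; rewrite lexx ler01 => /(_ isT); apply: le_trans. Qed.

Let in01 a r : 0 <= r -> 0 <= (a.+1%:R + r)^-1 <= 1.
Proof.
move=> r0; move: (pos a); move: (a.+1%:R) => x x1.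
by rewrite invr_ge0 invf_le1; lra.
Qed.

Lemma digit_operator_sup r : 0 <= r -> `|digit_operator M e f r| <= S.
Proof.
move=> r0; apply: (le_trans (ler_norm_sum _ _ _)).
apply: (@le_trans _ _ (\sum_(a < M) digit_weight a.+1 r * S)); last first.
  by rewrite -mulr_suml ler_piMl// sum_digit_weight_le1.
apply: ler_sum => a _; rewrite normrM ler_pM//; last exact/hf.1/in01.
have w0 := digit_weight_ge0 a r0.
by rewrite normrM [X in _ * X]ger0_norm// ler_piMl.
Qed.

(** The Lipschitz constant of the image is at most 1 * S from the variation of
    the weights plus 5/8 * 3 S from that of f, that is 23/8 * S. *)
Lemma digit_operator_lip r s : 0 <= r <= 1 -> 0 <= s <= 1 ->
  `|digit_operator M e f r - digit_operator M e f s| <= 23 / 8 * S * `|r - s|.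
Proof.
move=> hr hs; have /andP[r0 r1] := hr; have /andP[s0 s1] := hs.
rewrite /digit_operator -sumrB; apply: (le_trans (ler_norm_sum _ _ _)).
pose T1 (a : nat) := (a.+1%:R^-1 - a.+2%:R^-1 : R).
pose T2 (a : nat) := digit_weight a.+1 s / ((a.+1%:R + r) * (a.+1%:R + s)).
apply: (@le_trans _ _ (\sum_(a < M) (T1 a * (S * `|r - s|) + T2 a * (3 * S * `|r - s|)))).
  apply: ler_sum => a _.
  have -> : e a.+1 * digit_weight a.+1 r * f (a.+1%:R + r)^-1 -
      e a.+1 * digit_weight a.+1 s * f (a.+1%:R + s)^-1 =
      e a.+1 * ((digit_weight a.+1 r - digit_weight a.+1 s) * f (a.+1%:R + r)^-1 +
      digit_weight a.+1 s * (f (a.+1%:R + r)^-1 - f (a.+1%:R + s)^-1)) by ring.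
  rewrite normrM; apply: le_trans (ler_piMl (normr_ge0 _) (he _)) _.
  apply: (le_trans (ler_normD _ _)); apply: lerD; rewrite normrM.
    have := digit_weight_lip a hr hs; rewrite -/(T1 a) => h.
    by rewrite [S * _]mulrC mulrA; apply: ler_pM => //; exact/hf.1/in01.
  rewrite ger0_norm ?digit_weight_ge0// /T2 -mulrA ler_wpM2l ?digit_weight_ge0//.
  apply: (le_trans (hf.2 _ _ (in01 a r0) (in01 a s0))).
  by rewrite inv_diff// [leLHS]mulrA [leRHS]mulrC.
rewrite big_split/= -!mulr_suml.
have h1 := sum_inv_diff M; have h2 := sum_contraction M r0 hs.
have D0 : 0 <= S * `|r - s| by rewrite mulr_ge0.
have -> : 23 / 8 * S * `|r - s| = 1 * (S * `|r - s|) + 5 / 8 * (3 * S * `|r - s|) by field.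
apply: lerD; apply: ler_wpM2r => //.
by rewrite -mulrA mulr_ge0.
Qed.

Lemma digit_operator_tame : tame S (digit_operator M e f).
Proof.
split=> [r /andP[r0 _]|r s hr hs]; first exact: digit_operator_sup.
apply: (le_trans (digit_operator_lip hr hs)).
by rewrite ler_wpM2r// ler_wpM2r//; lra.
Qed.

End Bounds.

Lemma parity_sign_norm a : `|parity_sign a| = 1.
Proof. by rewrite /parity_sign; case: ifP; rewrite ?normrN normr1. Qed.

(** The digits 1 and 2 have opposite signs, the weight of 2 is at least 1/6,
    and f varies by at most 3 S (1/(1+r) - 1/(2+r)) between their images.
    This cancellation brings the supremum down to 11/12 * S, while the
    Lipschitz constant 23/8 * S is 23/24 of 3 S. *)
Lemma parity_operator_tame M f S : tame S f ->
  tame (23 / 24 * S) (digit_operator M.+2 parity_sign f).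
Proof.
move=> hf; have he a : `|parity_sign a| <= 1 by rewrite parity_sign_norm.
split=> [r|r s hr hs]; last first.
  apply: (le_trans (digit_operator_lip _ he hf hr hs)).
  by rewrite !mulrA ler_wpM2r// ler_wpM2r//; [|lra]; have := hf.1 0; rewrite lexx ler01 => /(_ isT); apply: le_trans.
move=> /andP[r0 r1].
have S0 : 0 <= S by have := hf.1 0; rewrite lexx ler01 => /(_ isT); apply: le_trans.
have i1 : 0 <= (1 + r)^-1 <= 1 by rewrite invr_ge0 invf_le1; lra.
have i2 : 0 <= (2 + r)^-1 <= 1 by rewrite invr_ge0 invf_le1; lra.
have hW := sum_digit_weight_le1 M.+2 r0; rewrite !big_ord_recl/= in hW; change (bump 0 0) with 1%N in hW.
rewrite /digit_operator !big_ord_recl/=; change (bump 0 0) with 1%N.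
have -> : parity_sign 1 = 1 by []. have -> : parity_sign 2 = -1 by [].
rewrite mul1r mulN1r.
set p1 := digit_weight 1 r in hW *; set p2 := digit_weight 2 r in hW *.
set W := \sum_(i < M) _ in hW; set Q := \sum_(i < M) _.
have hQ : `|Q| <= W * S.
  apply: (le_trans (ler_norm_sum _ _ _)); rewrite mulr_suml; apply: ler_sum => a _.
  rewrite /bump/= !add1n normrM normrM parity_sign_norm mul1r.
  have w0 := digit_weight_ge0 a.+2 r0; rewrite ger0_norm//.
  apply: ler_wpM2l => //.
  apply: hf.1; have x1 : 1 <= a.+3%:R :> R by rewrite ler1n.
  by rewrite invr_ge0 invf_le1; lra.
have p1E : p1 = (2 + r)^-1.
  by rewrite /p1 /digit_weight; field; apply/andP; split; rewrite gt_eqF//; lra.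
have p2E : p2 = (1 + r) / ((2 + r) * (3 + r)).
  by rewrite /p2 /digit_weight; congr (_ / (_ * _)); lra.
have p2ge : 1 / 6 <= p2.
  rewrite p2E ler_pdivlMr; last by rewrite mulr_gt0; lra.
  by nra.
have p12 : p2 <= p1.
  rewrite p2E p1E ler_pdivrMr; last by rewrite mulr_gt0; lra.
  by rewrite mulKf; [lra|rewrite gt_eqF//; lra].
have d12 : `|f (1 + r)^-1 - f (2 + r)^-1| <= 3 * S * ((1 + r)^-1 - (2 + r)^-1).
  apply: (le_trans (hf.2 _ _ i1 i2)); rewrite ler_wpM2l ?mulr_ge0//.
  by rewrite ger0_norm// subr_ge0 lef_pV2 ?posrE; lra.
have pd : p2 * ((1 + r)^-1 - (2 + r)^-1) <= 1 / 12.
  have -> : p2 * ((1 + r)^-1 - (2 + r)^-1) = ((2 + r) * (2 + r) * (3 + r))^-1.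
    by rewrite p2E; field; do ?[apply/andP; split]; rewrite gt_eqF//; lra.
  rewrite div1r lef_pV2 ?posrE ?mulr_gt0//; [nra|lra|lra|lra].
have f1 := hf.1 _ i1.
have main : `|p1 * f (1 + r)^-1 - p2 * f (2 + r)^-1| <=
    (p1 - p2) * S + 3 * S * (1 / 12).
  have -> : p1 * f (1 + r)^-1 - p2 * f (2 + r)^-1 =
    (p1 - p2) * f (1 + r)^-1 + p2 * (f (1 + r)^-1 - f (2 + r)^-1) by ring.
  apply: (le_trans (ler_normD _ _)); apply: lerD; rewrite normrM.
    by rewrite ger0_norm ?subr_ge0// ler_wpM2l ?subr_ge0.
  rewrite ger0_norm; last by lra.
  apply: (@le_trans _ _ (p2 * (3 * S * ((1 + r)^-1 - (2 + r)^-1)))).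
    by rewrite ler_wpM2l//; lra.
  by rewrite mulrCA ler_wpM2l// mulr_ge0.
rewrite mulNr addrA; apply: (le_trans (ler_normD _ _)).
apply: (le_trans (lerD main hQ)).
have : (W + p1 + p2) * S <= 1 * S by rewrite ler_wpM2r//; lra.
have : 1 / 6 * S <= p2 * S by rewrite ler_wpM2r.
by nra.
Qed.

End ParityOperator.

(** * Sums over words of digits *)

Section WordSums.
Variable R : realType.
Implicit Types (e : nat -> nat -> R) (H : seq nat -> R) (w : seq nat) (r : R).

(** The length of the cylinder of w relative to that of a block of ratio r
    preceding it. *)
Fixpoint word_weight r w : R :=
  if w is a :: w' then digit_weight a r * word_weight (a%:R + r)^-1 w' else 1.

Fixpoint word_prod e i w : R :=
  if w is a :: w' then e i a * word_prod e i.+1 w' else 1.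

(** Sum over the words of length L with digits between 1 and M. *)
Fixpoint word_sum M L H : R :=
  if L is L'.+1 then \sum_(a < M) word_sum M L' (fun w => H (a.+1 :: w)) else H [::].

Fixpoint word_operator M e i L : R -> R :=
  if L is L'.+1 then digit_operator M (e i) (word_operator M e i.+1 L')
  else fun=> 1.

Lemma eq_word_sum M L H1 H2 : H1 =1 H2 -> word_sum M L H1 = word_sum M L H2.
Proof. by move=> /funext ->. Qed.

Lemma word_sumZ M L c H : word_sum M L (fun w => c * H w) = c * word_sum M L H.
Proof.
elim: L H => //= L IH H; rewrite mulr_sumr; apply: eq_bigr => a _.
exact: IH.
Qed.

Lemma word_sum_sum M L (I : Type) (s : seq I) (F : I -> seq nat -> R) :
  word_sum M L (fun w => \sum_(i <- s) F i w) = \sum_(i <- s) word_sum M L (F i).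
Proof.
elim: L F => //= L IH F; rewrite exchange_big/=; apply: eq_bigr => a _.
exact: (IH (fun i w => F i (a.+1 :: w))).
Qed.

Lemma word_sum_le M L H1 H2 :
  (forall w, positive_word w -> size w = L -> H1 w <= H2 w) ->
  word_sum M L H1 <= word_sum M L H2.
Proof.
elim: L H1 H2 => [|L IH] H1 H2 h /=; first exact: h.
by apply: ler_sum => a _; apply: IH => w hw sw; apply: h; rewrite //= sw.
Qed.

(** Weights of words multiply along the digits, so summing out the digits one
    after the other applies one operator per position. *)
Lemma word_sum_operator M L e i r :
  word_sum M L (fun w => word_prod e i w * word_weight r w) = word_operator M e i L r.
Proof.
elim: L i r => [|L IH] i r /=; first by rewrite mulr1.
rewrite /digit_operator; apply: eq_bigr => a _.
rewrite -IH -word_sumZ; apply: eq_word_sum => w; ring.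
Qed.

Lemma word_prod_mkseq e i g L :
  word_prod e i (mkseq g L) = \prod_(k < L) e (i + k)%N (g k).
Proof.
elim: L i g => [|L IH] i g; first by rewrite big_ord0.
rewrite big_ord_recl addn0 /mkseq/= -[1%N]/(1 + 0)%N iotaDl -map_comp; congr (_ * _).
rewrite (IH i.+1 (g \o S)); apply: eq_bigr => k _.
by rewrite /bump/= addSnnS.
Qed.

Lemma word_prodM e1 e2 i w : word_prod (fun j a => e1 j a * e2 j a) i w =
  word_prod e1 i w * word_prod e2 i w.
Proof. by elim: w i => [|a w IH] i /=; rewrite ?mulr1// IH; ring. Qed.

Lemma word_prod_norm e i w : (forall j a, `|e j a| <= 1) -> `|word_prod e i w| <= 1.
Proof.
move=> he; elim: w i => [|a w IH] i /=; first by rewrite normr1.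
by rewrite normrM mulr_ile1.
Qed.

Lemma tame1 : tame 1 (fun=> 1 : R).
Proof.
by split=> [r _|r s _ _]; rewrite ?normr1// subrr normr0 !mulr_ge0.
Qed.

Lemma word_operator_tame M e (P : pred nat) L i : (forall j a, `|e j a| <= 1) ->
  (forall j, P j -> e j =1 @parity_sign R) ->
  tame ((23 / 24) ^+ count P (iota i L)) (word_operator M.+2 e i L).
Proof.
move=> he hP; elim: L i => [|L IH] i /=; first exact: tame1.
have [Pi|_] := boolP (P i); last by rewrite add0n; exact: digit_operator_tame.
by rewrite add1n exprS (funext (hP _ Pi)); exact: parity_operator_tame.
Qed.

(** Each position carrying the parity sign contributes a factor 23/24, the
    others at most 1. *)
Lemma word_operator_bound M e lo hi L : (hi <= L)%N -> (lo <= hi)%N ->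
  (forall j a, `|e j a| <= 1) ->
  (forall j, (lo <= j < hi)%N -> e j =1 @parity_sign R) ->
  `|word_operator M.+2 e 0 L 0| <= (23 / 24) ^+ (hi - lo).
Proof.
move=> hL lh he hs; have [+ _] := word_operator_tame M L 0 he hs.
move=> /(_ 0); rewrite lexx ler01 => /(_ isT) /le_trans; apply.
apply: ler_wiXn2l; [lra|lra|].
have -> : L = (lo + ((hi - lo) + (L - hi)))%N by lia.
rewrite iotaD iotaD !count_cat add0n.
rewrite (_ : count _ (iota lo (hi - lo)) = (hi - lo)%N); first by lia.
rewrite -{2}(size_iota lo (hi - lo)) -[RHS]count_predT.
apply: eq_in_count => j; rewrite mem_iota => /andP[lj jh].
by rewrite lj/=; lia.
Qed.

(** This is the measure of the cylinder of w for the density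
    (1 + r) / (1 + r t)^2, the conditional Lebesgue measure after a block of
    ratio r. *)
Lemma word_weight_length w r : positive_word w -> 0 <= r ->
  word_weight r w = (1 + r) * `|word_point pred0 w 1 - word_point pred0 w 0| /
    ((1 + r * word_point pred0 w 1) * (1 + r * word_point pred0 w 0)).
Proof.
elim: w r => [|a w IH] r /=.
  by move=> _ r0; rewrite subr0 normr1 mulr0 addr0 !mulr1 divff// gt_eqF//; lra.
move=> /andP[a0 hw] r0; have x1 : 1 <= a%:R :> R by rewrite ler1n.
rewrite IH//; last by rewrite invr_ge0; lra.
have z0 : 0 <= word_point pred0 w (0 : R) <= 1 by apply: word_point_01; rewrite // lexx ler01.
have z1 : 0 <= word_point pred0 w (1 : R) <= 1 by apply: word_point_01; rewrite // lexx ler01.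
rewrite /digit_weight /branch/=.
move: z0 z1 x1; move: (word_point _ _ _) (word_point _ _ _) (a%:R) => u v x.
move=> /andP[v0 v1] /andP[u0 u1] x1.
have xv : 0 < x + v by lra. have xu : 0 < x + u by lra.
have -> : (x + u)^-1 - (x + v)^-1 = (v - u) / ((x + u) * (x + v)).
  by field; apply/andP; split; rewrite gt_eqF.
rewrite normrM distrC [`|(_ * _)^-1|]ger0_norm ?invr_ge0 ?mulr_ge0 ?ltW//.
move: `|u - v| => d.
have rv : 0 <= r * v by rewrite mulr_ge0.
have ru : 0 <= r * u by rewrite mulr_ge0.
by field; do ?[apply/andP; split]; rewrite gt_eqF//; lra.
Qed.

Lemma word_weight0 w : positive_word w ->
  word_weight 0 w = `|word_point pred0 w 1 - word_point pred0 w 0|.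
Proof.
by move=> hw; rewrite word_weight_length// !mul0r !addr0 mul1r mulr1 invr1 mulr1.
Qed.

End WordSums.

(** * Parity of the number of even digits *)

Section ParityCancellation.
Variable R : realType.
Variables (x : R) (hx : Omega x) (m : (nat -> R) -> R) (hm : invariant_mean m).
Hypothesis rcf_equi : forall c : R, rational c -> 0 <= c <= 1 ->
  m (fun n => \1(rcf_orbit x n < c)) = rcf_cdf c.

Let t n := rcf_orbit x n.
Let a n := quot (t n).
Let C : R := (ln 2)^-1.

Lemma inv_ln2_gt0 : 0 < C.
Proof. by rewrite invr_gt0 ln_gt0//; lra. Qed.

Definition digits n L := mkseq (fun i => a (n + i)) L.

Lemma digit_gt0 n : (0 < a n)%N.
Proof. by have [] := quot_itv (rcf_orbit_Omega hx n). Qed.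

Lemma digitsS n L : digits n L.+1 = a n :: digits n.+1 L.
Proof.
rewrite /digits /mkseq/= addn0 -[1%N]/(1 + 0)%N iotaDl -map_comp; congr (_ :: _).
by apply: eq_map => i /=; rewrite add1n addnS addSn.
Qed.

Lemma positive_digits n L : positive_word (digits n L).
Proof. by apply/allP => j /mapP[i _ ->]; exact: digit_gt0. Qed.

Lemma starts_with_digits w n :
  starts_with pred0 w (t n) = (digits n (size w) == w).
Proof.
elim: w n => [|j w IH] n //=; rewrite digitsS eqseq_cons.
by congr (_ && _); rewrite -IH.
Qed.

(** The RCF density is at most 1 / ln 2. *)
Lemma rcf_cdf_lip (b c : R) : 0 <= b -> b <= c -> rcf_cdf c - rcf_cdf b <= C * (c - b).
Proof.
move=> b0 bc; rewrite /rcf_cdf -mulrBl mulrC ler_wpM2l ?(ltW inv_ln2_gt0)//.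
rewrite -ln_div ?posrE; [|lra|lra].
have -> : (1 + c) / (1 + b) = 1 + (c - b) / (1 + b) by field; rewrite gt_eqF//; lra.
have h0 : 0 <= (c - b) / (1 + b) by rewrite divr_ge0; lra.
apply: (le_trans (le_ln1Dx _)); first by lra.
by rewrite ler_pdivrMr; nra.
Qed.

(** A cylinder is an interval, so the mean of its indicator against any
    bounded sequence is an increment of distribution functions. *)
Lemma mean_starts_with w : positive_word w ->
  exists b c : R, [/\ b <= c, rational b /\ rational c, 0 <= b, c <= 1 &
    forall g : nat -> R, bounded_seq g -> m (fun n => g n * \1(digits n (size w) == w)) =
    m (fun n => g n * \1(t n < c)) - m (fun n => g n * \1(t n < b))] /\
    (b = word_point pred0 w 0 /\ c = word_point pred0 w 1 \/
     c = word_point pred0 w 0 /\ b = word_point pred0 w 1).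
Proof.
move=> hw.
have r0 : rational (0 : R) by exact: (rational_nat R 0).
have r1 : rational (1 : R) by exact: (rational_nat R 1).
have key b c : b <= c -> rational b ->
    (forall y : R, Omega y -> starts_with pred0 w y = between b c y) ->
    forall g : nat -> R, bounded_seq g -> m (fun n => g n * \1(digits n (size w) == w)) =
    m (fun n => g n * \1(t n < c)) - m (fun n => g n * \1(t n < b)).
  move=> bc rb hbc g bg; rewrite -meanB//; try exact/bndM/bnd_nat.
  congr m; apply/funext => n; have ht := rcf_orbit_Omega hx n.
  have /OmegaP[_ _ nt] := ht.
  by rewrite -starts_with_digits hbc// between_indicator// mulrBr.
have /andP[u0 u1] : 0 <= word_point pred0 w (0 : R) <= 1 by apply: word_point_01; rewrite // lexx ler01.
have /andP[v0 v1] : 0 <= word_point pred0 w (1 : R) <= 1 by apply: word_point_01; rewrite // lexx ler01.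
have ru := rational_word_point pred0 w r0; have rv := rational_word_point pred0 w r1.
have /orP[uv|vu] := le_total (word_point pred0 w (0 : R)) (word_point pred0 w 1).
  exists (word_point pred0 w 0), (word_point pred0 w 1); split; last by left.
  by split=> //; apply: key => // y hy; exact: starts_with_between.
exists (word_point pred0 w 1), (word_point pred0 w 0); split; last by right.
by split=> //; apply: key => // y hy; rewrite starts_with_between// betweenC.
Qed.

Lemma mean_word_le w : positive_word w ->
  m (fun n => \1(digits n (size w) == w)) <= C * word_weight 0 w.
Proof.
move=> hw; have [b [c [[bc [rb rc] b0 c1 Eg] hbc]]] := mean_starts_with hw.
have E1 p : (fun n => 1 * \1(p n) : R) = (fun n => \1(p n)).
  by apply/funext => n; rewrite mul1r.
have := Eg _ (bnd_cst 1); rewrite !E1 => ->.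
rewrite !rcf_equi ?b0 ?c1 ?(le_trans b0 bc) ?(le_trans bc c1)//.
rewrite word_weight0//; apply: (le_trans (rcf_cdf_lip b0 bc)).
rewrite ler_wpM2l ?(ltW inv_ln2_gt0)//.
by case: hbc => -[-> ->]; rewrite ?ler_norm// distrC ler_norm.
Qed.

Lemma mean_large_digit M : m (fun n => \1((M < a n)%N)) <= C * M.+1%:R^-1.
Proof.
have M0 : 0 < M.+1%:R :> R by rewrite ltr0n.
have M1 : 0 <= (M.+1%:R^-1 : R) <= 1.
  by rewrite invr_ge0 ltW//= invf_le1// ler1n.
apply: (@le_trans _ _ (m (fun n => \1(t n < M.+1%:R^-1)))).
  apply: mean_le => //; try exact: bnd_nat.
  move=> n; case: ltnP => // Mn; have ht := rcf_orbit_Omega hx n.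
  have [_ h _] := quot_itv ht; have /OmegaP[t0 _ _] := ht.
  suff -> : t n < M.+1%:R^-1 by [].
  rewrite -[t n]invrK ltf_pV2 ?posrE ?invr_gt0//.
  by apply: le_lt_trans h; rewrite ler_nat.
rewrite rcf_equi//; last by apply: rationalV; exact: rational_nat.
have := @rcf_cdf_lip 0 M.+1%:R^-1 (lexx _); rewrite subr0 {2}/rcf_cdf addr0 ln1 mul0r subr0.
by apply; case/andP: M1.
Qed.

Lemma word_sum_ge0 M L (H : seq nat -> R) : (forall w, 0 <= H w) -> 0 <= word_sum M L H.
Proof. by elim: L H => //= L IH H h; apply: sumr_ge0 => i _; exact: IH. Qed.

Lemma truncate_word M (H : seq nat -> R) s : positive_word s ->
  (forall w, 0 <= H w <= 1) ->
  H s <= word_sum M (size s) (fun w => H w * \1(s == w)) + \sum_(j <- s) \1((M < j)%N).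
Proof.
elim: s H => [|j s IH] H /=; first by move=> _ _; rewrite mulr1 big_nil addr0.
move=> /andP[j0 hs] hH; rewrite big_cons.
have sum0 : 0 <= \sum_(j <- s) \1((M < j)%N) :> R by apply: sumr_ge0.
have ws0 i : 0 <= word_sum M (size s) (fun w => H (i :: w) * \1(j :: s == i :: w)).
  by apply: word_sum_ge0 => w; rewrite mulr_ge0//; have /andP[] := hH (i :: w).
case: ltnP => Mj.
  have /andP[_ h1] := hH (j :: s); apply: (le_trans h1).
  by rewrite [leRHS]addrCA lerDl addr_ge0// sumr_ge0.
case: j j0 Mj ws0 {hH} (hH) => // j _ jM ws0 hH.
rewrite (bigD1 (Ordinal jM))//= add0r -addrA.
apply: (le_trans (IH (fun w => H (j.+1 :: w)) hs (fun w => hH _))).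
rewrite lerD//; first by apply: word_sum_le => w _ _; rewrite eqseq_cons eqxx.
by rewrite lerDr sumr_ge0.
Qed.

Lemma mean_word_sum M L (F : seq nat -> nat -> R) : (forall w, bounded_seq (F w)) ->
  bounded_seq (fun n => word_sum M L (fun w => F w n)) /\
  m (fun n => word_sum M L (fun w => F w n)) = word_sum M L (fun w => m (F w)).
Proof.
elim: L F => //= L IH F hF; split.
  by apply: bnd_sum => i; exact: (IH (fun w => F (i.+1 :: w)) (fun w => hF _)).1.
rewrite mean_sum//; first by apply: eq_bigr => i _; exact: (IH (fun w => F (i.+1 :: w)) (fun w => hF _)).2.
by move=> i; exact: (IH (fun w => F (i.+1 :: w)) (fun w => hF _)).1.
Qed.

(** Blocks containing a digit above M are rare, and the others are finitely
    many words to which mean_word_le applies. *)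
Lemma mean_digits_le M L (H : seq nat -> R) : (forall w, 0 <= H w <= 1) ->
  m (fun n => H (digits n L)) <=
  C * word_sum M L (fun w => H w * word_weight 0 w) + L%:R * (C * M.+1%:R^-1).
Proof.
move=> hH; pose F w n := H w * \1(digits n L == w).
have bF w : bounded_seq (F w) by apply: bndM; [exact: bnd_cst|exact: bnd_nat].
have [bS mS] := mean_word_sum M L bF.
have bT (i : 'I_L) : bounded_seq (fun n => \1((M < a (n + i))%N) : R) by exact: bnd_nat.
apply: (@le_trans _ _ (m (fun n => word_sum M L (fun w => F w n) +
    \sum_(i < L) \1((M < a (n + i))%N)))).
  apply: mean_le => //.
  - by exists 1 => n; have /andP[h0 h1] := hH (digits n L); rewrite ger0_norm.
  - by apply: bndD => //; exact: bnd_sum.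
  - move=> n; apply: (le_trans (truncate_word M (positive_digits n L) hH)).
    rewrite size_mkseq big_map -(big_mkord xpredT (fun i => \1((M < a (n + i))%N) : R)).
    by rewrite /index_iota subn0.
rewrite meanD//; last exact: bnd_sum.
rewrite mS mean_sum//; apply: lerD.
  rewrite -word_sumZ; apply: word_sum_le => w hw sw; rewrite /F meanZ//; last exact: bnd_nat.
  rewrite mulrCA; have /andP[h0 _] := hH w; apply: ler_wpM2l => //.
  by rewrite -sw; exact: mean_word_le.
apply: (@le_trans _ _ (\sum_(i < L) C * M.+1%:R^-1)).
  apply: ler_sum => i _; rewrite (mean_shift hm (f := fun n => \1((M < a n)%N))); last exact: bnd_nat.
  exact: mean_large_digit.
by rewrite sumr_const card_ord mulr_natl.
Qed.

Definition parity_upto n : R := \prod_(i < n) parity_sign R (a i).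

(** The factor contributed by digit b at position i to the indicator that u
    occurs after l digits, multiplied by the parity sign of these l digits. *)
Definition window (u : seq nat) l i b : R :=
  if (i < l)%N then parity_sign R b
  else if (i < l + size u)%N then \1(b == nth 0%N u (i - l)) else 1.

Lemma window_norm u l i b : `|window u l i b| <= 1.
Proof.
rewrite /window; case: ifP => _; first by rewrite parity_sign_norm.
by case: ifP => _; [case: (_ == _)|]; rewrite ?normr1 ?normr0.
Qed.

Lemma digits_eq_prod u n :
  \1(digits n (size u) == u) = \prod_(k < size u) \1(a (n + k) == nth 0%N u k) :> R.
Proof.
elim: u n => [|b u IH] n /=; first by rewrite big_ord0.
rewrite digitsS eqseq_cons big_ord_recl/= addn0.
under eq_bigr do rewrite /bump/= add1n addnS -addSn.
by rewrite -IH; case: (a n == b); rewrite ?mul1r ?mul0r.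
Qed.

Lemma window_shift u l n L : (l + size u <= L)%N ->
  parity_upto (n + l) * \1(digits (n + l) (size u) == u) =
  parity_upto n * word_prod (window u l) 0 (digits n L).
Proof.
move=> lL; rewrite word_prod_mkseq.
have -> : L = (l + (size u + (L - (l + size u))))%N by lia.
rewrite /parity_upto big_split_ord/= -mulrA; congr (_ * _).
rewrite digits_eq_prod !big_split_ord/= [X in _ * (_ * X)]big1 ?mulr1.
  congr (_ * _); apply: eq_bigr => k _; rewrite /window !add0n ?ltn_ord//.
  by rewrite ltnNge leq_addr/= ltn_add2l ltn_ord addKn addnA.
by move=> k _; rewrite /window add0n !ifF//; lia.
Qed.

Lemma parity_upto_sqr n : parity_upto n ^+ 2 = 1.
Proof.
rewrite /parity_upto -prodrXl big1// => i _.
by rewrite /parity_sign; case: ifP => _; rewrite ?sqrrN expr1n.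
Qed.

Lemma bnd_parity_upto : bounded_seq parity_upto.
Proof.
exists 1 => n; rewrite /parity_upto normr_prod big1// => i _.
exact: parity_sign_norm.
Qed.

(** The shifts by multiples of d are averaged.  Spacing them by d rather than
    by 1 makes every pair of different shifts decorrelated. *)
Section Correlation.
Variables (u : seq nat) (K d : nat).
Hypotheses (hK : (0 < K)%N) (hd : (size u <= d)%N).
Let L := (K * d + size u)%N.
Let rho : R := 23 / 24.

Let avg w : R := K%:R^-1 * \sum_(k < K) word_prod (window u (k * d)) 0 w.

Let K0 : 0 < K%:R :> R. Proof. by rewrite ltr0n. Qed.

Let avg_norm w : `|avg w| <= 1.
Proof.
rewrite /avg normrM normfV normr_nat mulrC ler_pdivrMr// mul1r.
apply: (le_trans (ler_norm_sum _ _ _)).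
apply: (@le_trans _ _ (\sum_(k < K) 1)); last by rewrite sumr_const card_ord.
by apply: ler_sum => k _; apply: word_prod_norm => i b; exact: window_norm.
Qed.

Let avg_sqr w : 0 <= avg w ^+ 2 <= 1.
Proof. by rewrite sqr_ge0/= -real_normK ?num_real// expr_le1// normr_ge0. Qed.

(** In the product of two windows the signs cancel before the first occurrence
    of u, and remain between the end of that occurrence and the second one. *)
Let off_diagonal M (k k' : 'I_K) : (k < k')%N ->
  `|word_operator M.+2 (fun j b => window u (k * d) j b * window u (k' * d) j b) 0 L 0|
    <= rho ^+ (d - size u).
Proof.
move=> kk.
have dk : (k * d + d <= k' * d)%N by rewrite -mulSnr leq_mul2r kk orbT.
have k'L : (k' * d <= L)%N.
  by rewrite /L (leq_trans _ (leq_addr _ _))// leq_mul2r (ltnW (ltn_ord k')) orbT.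
apply: (@le_trans _ _ (rho ^+ (k' * d - (k * d + size u)))).
  apply: word_operator_bound => //; first by lia.
    by move=> j b; rewrite normrM mulr_ile1// window_norm.
  move=> j /andP[j1 j2] b; rewrite /window j2.
  by rewrite ifF ?ifF ?mul1r//; lia.
by apply: ler_wiXn2l; rewrite /rho; [lra|lra|lia].
Qed.

Let mean_square M : word_sum M.+2 L (fun w => avg w ^+ 2 * word_weight 0 w) <=
  K%:R^-1 + rho ^+ (d - size u).
Proof.
pose V (k k' : 'I_K) j b := window u (k * d) j b * window u (k' * d) j b.
have E : (fun w => avg w ^+ 2 * word_weight 0 w) =1
    (fun w => K%:R^-2 * \sum_(k < K) \sum_(k' < K)
      word_prod (V k k') 0 w * word_weight 0 w).
  move=> w; rewrite /avg exprMn exprVn -mulrA; congr (_ * _).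
  rewrite expr2 mulr_suml mulr_suml; apply: eq_bigr => k _.
  rewrite mulr_sumr mulr_suml; apply: eq_bigr => k' _.
  by rewrite word_prodM.
rewrite (eq_word_sum _ _ E) word_sumZ word_sum_sum.
under eq_bigr do rewrite word_sum_sum.
under eq_bigr do under eq_bigr do rewrite word_sum_operator.
have bound (k k' : 'I_K) : word_operator M.+2 (V k k') 0 L 0 <=
    \1(k' == k) + rho ^+ (d - size u).
  apply: (le_trans (ler_norm _)).
  have r0 : 0 <= rho ^+ (d - size u) by rewrite exprn_ge0// /rho; lra.
  have [kk|kk|kk] := ltngtP k k'.
  - by apply: (le_trans (off_diagonal M kk)); rewrite lerDr.
  - have := off_diagonal M kk; under eq_fun do under eq_fun do rewrite mulrC.
    by move=> h; apply: (le_trans h); rewrite lerDr.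
  - rewrite (val_inj kk) eqxx; apply: (@le_trans _ _ 1); last by rewrite lerDl.
    rewrite -(expr0 rho) -{2}(subnn 0%N).
    apply: word_operator_bound => // j b.
    by rewrite normrM mulr_ile1// window_norm.
apply: (@le_trans _ _ (K%:R^-2 * \sum_(k < K) \sum_(k' < K) (\1(k' == k) + rho ^+ (d - size u)))).
  rewrite ler_wpM2l ?invr_ge0 ?exprn_ge0//.
  by apply: ler_sum => k _; apply: ler_sum => k' _; exact: bound.
under eq_bigr => k _.
  rewrite big_split/= (bigD1 k)//= eqxx big1 => [|k' /negbTE ->//].
  rewrite sumr_const card_ord addr0; over.
rewrite sumr_const card_ord -[(_ + _) *+ K]mulr_natr.
move: (rho ^+ _) => p; rewrite -[p *+ K]mulr_natr.
rewrite [leLHS](_ : _ = K%:R^-1 + p)//.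
by rewrite /=; field; exact: lt0r_neq0.
Qed.

(** By shift invariance the mean is also that of the parity sign times an
    average over K shifts; the sign disappears in the square. *)
Lemma correlation_bound M :
  m (fun n => parity_upto n * \1(digits n (size u) == u)) ^+ 2 <=
  C * (K%:R^-1 + rho ^+ (d - size u)) + L%:R * (C * M.+3%:R^-1).
Proof.
pose f n : R := parity_upto n * \1(digits n (size u) == u).
have bf : bounded_seq f by apply: bndM; [exact: bnd_parity_upto|exact: bnd_nat].
have ba : bounded_seq (fun n => avg (digits n L)) by exists 1 => n; exact: avg_norm.
have fE : m f = m (fun n => parity_upto n * avg (digits n L)).
  have -> : (fun n => parity_upto n * avg (digits n L)) =
      (fun n => K%:R^-1 * \sum_(k < K) f (n + k * d)%N).
    apply/funext => n; rewrite /avg mulrCA; congr (_ * _).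
    rewrite mulr_sumr; apply: eq_bigr => k _; rewrite /f (@window_shift _ _ _ L)//.
    by rewrite /L leq_add2r leq_mul2r (ltnW (ltn_ord k)) orbT.
  have bs (k : 'I_K) : bounded_seq (fun n => f (n + k * d)%N) by exact: bnd_shift.
  rewrite meanZ// ?mean_sum//; last exact: bnd_sum.
  under eq_bigr do rewrite (mean_shift hm _ bf).
  by rewrite sumr_const card_ord -[m f *+ K]mulr_natl mulKf// lt0r_neq0.
rewrite -/f fE; apply: (le_trans (mean_sqr hm (bndM bnd_parity_upto ba))).
under eq_fun do rewrite exprMn parity_upto_sqr mul1r.
apply: (le_trans (mean_digits_le M.+2 L (H := fun w => avg w ^+ 2) avg_sqr)).
by rewrite lerD2r ler_wpM2l ?(ltW inv_ln2_gt0).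
Qed.

End Correlation.

Lemma small_fraction (c eps : R) : 0 < eps -> 0 <= c -> exists n, c * n.+1%:R^-1 <= eps.
Proof.
move=> e0 c0; exists (Num.bound (c / eps)); rewrite ler_pdivrMr ?ltr0n//.
have := archi_boundP (divr_ge0 c0 (ltW e0)).
by rewrite ltr_pdivrMr// => /ltW h; apply: (le_trans h); rewrite mulrC ler_wpM2l ?(ltW e0)// ler_nat.
Qed.

(** Let M, then d, then K tend to infinity in correlation_bound. *)
Lemma parity_cancellation u :
  m (fun n => parity_upto n * \1(digits n (size u) == u)) = 0.
Proof.
have bound := @correlation_bound u; move: bound; set z := m _ => bound.
apply/eqP; rewrite -sqrf_eq0 eq_le sqr_ge0 andbT leNgt; apply/negP => z0.
have C0 := ltW inv_ln2_gt0.
have z4 : 0 < z ^+ 2 / 4 by rewrite divr_gt0.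
have [n hn] := small_fraction z4 C0.
have [k hk] : exists k, C * (23 / 24) ^+ k <= z ^+ 2 / 4.
  have r1 : `|23 / 24 : R| < 1 by rewrite ger0_norm; lra.
  have e0 : 0 < z ^+ 2 / 4 / C by rewrite divr_gt0// inv_ln2_gt0.
  have /cvgr0_norm_le/(_ _ e0)[k _ /(_ k (leqnn _))] := cvg_expr r1.
  move=> h; exists k; rewrite mulrC -ler_pdivlMr ?inv_ln2_gt0//.
  exact: le_trans (ler_norm _) h.
have LC : 0 <= (n.+1 * (k + size u) + size u)%:R * C by rewrite mulr_ge0.
have [M hM] := small_fraction z4 LC.
have := bound n.+1 (k + size u)%N isT (leq_addl _ _) M.
rewrite addnK mulrDr.
have hM' : (n.+1 * (k + size u) + size u)%:R * (C * M.+3%:R^-1) <= z ^+ 2 / 4.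
  rewrite mulrA; apply: le_trans hM; rewrite ler_wpM2l//.
  by rewrite lef_pV2 ?posrE ?ltr0n// ler_nat; lia.
by move=> h; have := le_trans h (lerD (lerD hn hk) hM'); lra.
Qed.

(** Phase Direct is left and entered exactly at even digits. *)
Lemma parity_upto_phase n :
  parity_upto n = if phase_at x n is Direct then 1 else -1.
Proof.
elim: n => [|n IH]; first by rewrite /parity_upto big_ord0.
rewrite /parity_upto big_ord_recr/= -/(parity_upto n) IH /parity_sign -/(t n) -/(a n).
case: (phase_at x n) => /=; rewrite ?mul1r ?mulN1r.
- by case: (odd _).
- by case: eqP => [->//|_]; case: (odd _); rewrite ?opprK.
- by case: (odd _); rewrite ?opprK.
Qed.

Definition is_direct s := if s is Direct then true else false.

(** On each cylinder the indicator of phase Direct is (1 + sign) / 2, and the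
    sign has mean zero there; cylinders determine the distribution. *)
Lemma mean_direct (y : R) : rational y -> 0 <= y <= 1 ->
  m (fun n => \1(is_direct (phase_at x n)) * \1(t n < y)) = rcf_cdf y / 2.
Proof.
have bd : bounded_seq (fun n => \1(is_direct (phase_at x n)) : R) by exact: bnd_nat.
have half w : positive_word w ->
    m (fun n => \1(is_direct (phase_at x n)) * \1(digits n (size w) == w)) =
    m (fun n => 1 * \1(digits n (size w) == w)) / 2.
  move=> hw; have bw : bounded_seq (fun n => \1(digits n (size w) == w) : R) by exact: bnd_nat.
  have -> : (fun n => \1(is_direct (phase_at x n)) * \1(digits n (size w) == w)) =
    (fun n => 2^-1 * (\1(digits n (size w) == w) +
      parity_upto n * \1(digits n (size w) == w)) : R).
    apply/funext => n; rewrite parity_upto_phase.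
    by case: (phase_at x n) => /=; field.
  have bp := bndM bnd_parity_upto bw.
  rewrite (meanZ hm _ (bndD bw bp)) (meanD hm bw bp).
  rewrite parity_cancellation addr0 mulrC; congr (m _ / 2).
  by apply/funext => n; rewrite mul1r.
have E1 p : (fun n => 1 * \1(p n) : R) = (fun n => \1(p n)).
  by apply/funext => n; rewrite mul1r.
pose N c := m (fun n => \1(is_direct (phase_at x n)) * \1(t n < c)).
pose E b c := N b - rcf_cdf b / 2 = N c - rcf_cdf c / 2.
have Ew w : positive_word w -> E (word_point pred0 w 0) (word_point pred0 w 1).
  move=> hw; have [b [c [[bc [rb rc] b0 c1 Eg] hbc]]] := mean_starts_with hw.
  have Ebc : E b c.
    have := half w hw; rewrite !Eg//; last exact: bnd_cst.
    rewrite -/(N b) -/(N c) !E1 !rcf_equi ?b0 ?c1 ?(le_trans b0 bc) ?(le_trans bc c1)//.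
    by rewrite /E; lra.
  by case: hbc => -[<- <-].
move=> ry y01.
have : E 0 y.
  apply: (cylinders_determine_rationals (E := E) (e := pred0)) => //; rewrite /E//.
  by move=> ? ? ? -> ->.
have N0 : N 0 = 0.
  rewrite /N -[RHS](mean_zero hm); congr m; apply/funext => n.
  by have /OmegaP[t0 _ _] := rcf_orbit_Omega hx n; rewrite /t lt_gtF// mulr0.
by rewrite /E N0 /rcf_cdf addr0 ln1 !mul0r -/(N y); lra.
Qed.

End ParityCancellation.

(** * The relations between the phases *)

Section GoldenLogarithms.
Variable R : realType.
Local Notation G := (golden R).
Implicit Types c u : R.

Lemma golden_gt0 : 0 < G. Proof. by have /andP[] := golden_itv R; lra. Qed.

Lemma ln_golden_gt0 : 0 < ln G.
Proof. by rewrite ln_gt0//; have /andP[] := golden_itv R; lra. Qed.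

Lemma ln_golden1 : ln (G + 1) = 2 * ln G.
Proof. by rewrite -golden_sqr lnM ?posrE ?golden_gt0//; ring. Qed.

Lemma ln_golden_ratio c : 0 <= c -> ln (G + c / (1 + c)) = ln G + ln (1 + G * c) - ln (1 + c).
Proof.
move=> c0; have G0 := golden_gt0; have h1 : 0 < 1 + c by lra.
have h2 : 0 < 1 + G * c by rewrite ltr_wpDr// mulr_ge0// ltW.
rewrite -lnM ?posrE// -ln_div ?posrE ?mulr_gt0//; congr ln.
have -> : G * (1 + G * c) = G + (G + 1) * c by rewrite -golden_sqr; ring.
by field; rewrite gt_eqF.
Qed.

Lemma ln_golden_inv c : 0 <= c -> ln (G + (1 + c)^-1) = ln G + ln (G + c) - ln (1 + c).
Proof.
move=> c0; have G0 := golden_gt0; have h1 : 0 < 1 + c by lra.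
have h2 : 0 < G + c by lra.
rewrite -lnM ?posrE// -ln_div ?posrE ?mulr_gt0//; congr ln.
have -> : G * (G + c) = G + 1 + G * c by rewrite -golden_sqr; ring.
by field; rewrite gt_eqF.
Qed.

Lemma ln_golden_mirror c : c <= 1 -> ln (1 - (2 - G) * c) = ln (G + 1 - c) - 2 * ln G.
Proof.
move=> c1; have G0 := golden_gt0.
rewrite -ln_golden1 -ln_div ?posrE; [|lra|lra]; congr ln.
apply: (@mulIf _ (G + 1)); first by rewrite gt_eqF//; lra.
rewrite divfK; last by rewrite gt_eqF//; lra.
have : (2 - G) * (G + 1) = 1 by have := golden_sqr R; lra.
by move=> h; rewrite mulrBl mul1r mulrAC h mul1r.
Qed.

Lemma ocf_cdf1 : ocf_cdf 1 = 1 :> R.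
Proof.
rewrite /ocf_cdf ln_golden_mirror// !mulr1 addrK [1 + G]addrC ln_golden1.
have -> : 2 * ln G - (ln G - 2 * ln G) = 3 * ln G by ring.
by rewrite divff// gt_eqF// mulr_gt0// ln_golden_gt0.
Qed.

Lemma ocf_cdf_inv u : 1 <= u ->
  ocf_cdf u^-1 = (ln (u + G) - ln (u + G - 2)) / (3 * ln G).
Proof.
move=> u1; have /andP[G1 G2] := golden_itv R; have u0 : 0 < u by lra.
rewrite /ocf_cdf; congr (_ / _).
have -> : 1 + G * u^-1 = (u + G) / u by field; rewrite gt_eqF.
have -> : 1 - (2 - G) * u^-1 = (u + G - 2) / u by field; rewrite gt_eqF.
by rewrite !ln_div ?posrE; try lra; ring.
Qed.

End GoldenLogarithms.

Section PhaseDistributions.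
Variable R : realType.
Variables (x : R) (hx : Omega x) (m : (nat -> R) -> R) (hm : invariant_mean m).
Local Notation G := (golden R).

Let t n := rcf_orbit x n.
Let a n := quot (t n).
Let s n := phase_at x n.

Definition is_mirror p := if p is Mirror then true else false.
Definition is_wait p := if p is Wait then true else false.

Definition direct_cdf c := m (fun n => \1(is_direct (s n)) * \1(t n < c)).
Definition mirror_cdf c := m (fun n => \1(is_mirror (s n)) * \1(t n < c)).
Definition wait_cdf c := m (fun n => \1(is_wait (s n)) * \1(t n < c)).
Definition emitted_cdf c := m (fun n => \sum_(y <- emitted_at x n) \1(y < c)).

Let bnd_ind (p : nat -> bool) (q : nat -> bool) : bounded_seq (fun n => \1(p n) * \1(q n) : R).
Proof. by apply: bndM; exact: bnd_nat. Qed.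

Lemma bnd_emitted (h : R -> R) : (forall y, `|h y| <= 1) ->
  bounded_seq (fun n => \sum_(y <- emitted_at x n) h y).
Proof.
move=> h1; exists 2 => n; rewrite /emitted_at; case: (phase_at x n) => /=.
- by rewrite big_seq1 (le_trans (h1 _))//; lra.
- case: ifP => _; first by rewrite big_seq1 (le_trans (h1 _))//; lra.
  rewrite big_cons big_seq1; apply: (le_trans (ler_normD _ _)).
  by have := lerD (h1 (1 - rcf_orbit x n)) (h1 (rcf_orbit x n / (1 - rcf_orbit x n))); lra.
- by rewrite big_nil normr0.
Qed.

Let norm_ind (p : bool) : `|\1(p) : R| <= 1.
Proof. by case: p; rewrite ?normr1 ?normr0. Qed.

Lemma total_cdf c :
  m (fun n => \1(t n < c)) = direct_cdf c + mirror_cdf c + wait_cdf c.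
Proof.
rewrite /direct_cdf /mirror_cdf /wait_cdf -!meanD//; last exact: bndD.
by congr m; apply/funext => n; case: (s n); rewrite ?mul1r ?mul0r ?addr0 ?add0r.
Qed.

Lemma orbit_facts n : [/\ 0 < t n, t n < 1, ~ rational (t n) & (0 < a n)%N].
Proof.
have h := rcf_orbit_Omega hx n; have /OmegaP[? ? ?] := h; have [? _ _] := quot_itv h.
by split.
Qed.

Lemma orbit_step n : t n = ((a n)%:R + t n.+1)^-1.
Proof. exact: gauss_inv (rcf_orbit_Omega hx n). Qed.

Lemma ind_complement (y c : R) : y != c -> \1(y < c) = 1 - \1(c < y) :> R.
Proof. by case: (ltgtP y c); rewrite ?subr0 ?subrr. Qed.

(** Phase Wait is entered from phase Mirror by the digit 1, that is from
    t = 1 / (1 + z), and z < c means t > 1 / (1 + c). *)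
Lemma wait_cdfE c : rational c -> 0 <= c <= 1 ->
  wait_cdf c = mirror_cdf 1 - mirror_cdf (1 + c)^-1.
Proof.
move=> rc /andP[c0 c1]; rewrite /wait_cdf /mirror_cdf -meanB//.
rewrite -(mean_shift1 hm) //; congr m; apply/funext => n.
have [t0 t1 nt a0] := orbit_facts n; have [u0 u1 _ _] := orbit_facts n.+1.
rewrite t1 -mulrBr (_ : s n.+1 = next_phase (s n) (a n))//.
have ne : t n != (1 + c)^-1.
  apply: irrational_neq => //; apply: rationalV; apply: rationalD => //.
  exact: (rational_nat R 1).
rewrite (ind_complement ne) subKr; have := orbit_step n.
move: (t n.+1) u0 u1 => z z0 z1 tE.
case: (s n) => /=; rewrite ?mul0r ?mul1r; try by case: (odd _); rewrite mul0r.
case: eqP => [a1|/eqP a1] /=.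
  rewrite mul1r tE a1 ltf_pV2 ?posrE; [|lra|lra].
  by rewrite ltrD2l.
have a2 : 2 <= (a n)%:R :> R by rewrite ler_nat; move: (a n) a0 a1 => [|[|]].
rewrite (_ : (1 + c)^-1 < t n = false); first by case: (odd _); rewrite mul0r.
by apply/negbTE; rewrite -leNgt tE lef_pV2 ?posrE; lra.
Qed.

(** The emitted points are t in phase Direct, and in phase Mirror 1 - t and,
    when t < 1/2, also t / (1 - t). *)
Lemma emitted_cdfE c : rational c -> 0 <= c <= 1 ->
  emitted_cdf c = direct_cdf c + (mirror_cdf 1 - mirror_cdf (1 - c)) +
    mirror_cdf (c / (1 + c)).
Proof.
move=> rc /andP[c0 c1]; rewrite /emitted_cdf /direct_cdf /mirror_cdf.
rewrite -meanB//.
have bB : bounded_seq (fun n => \1(is_mirror (s n)) * \1(t n < 1) -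
    \1(is_mirror (s n)) * \1(t n < 1 - c) : R) by apply: bndD => //; exact: bndN.
rewrite -!meanD//; last exact: bndD.
  congr m; apply/funext => n; have [t0 t1 nt a0] := orbit_facts n.
  rewrite t1 /emitted_at -/(s n) -/(t n).
  case: (s n) => /=; rewrite ?mul0r ?mul1r ?subr0 ?addr0 ?add0r.
  - by rewrite big_seq1.
  - have ne : t n != 1 - c.
      apply: irrational_neq => //; apply: rationalB => //; exact: (rational_nat R 1).
    have E1 : \1(1 - t n < c) = 1 - \1(t n < 1 - c) :> R.
      by rewrite (ind_complement ne) subKr; congr (nat_of_bool _)%:R; apply/idP/idP; lra.
    have cc : 0 < 1 + c by lra.
    have tE := orbit_step n; have [u0 u1 _ _] := orbit_facts n.+1.
    case: eqP => [q1|/eqP q1]; rewrite ?big_cons big_nil addr0 E1.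
      rewrite (_ : t n < c / (1 + c) = false) ?addr0//.
      apply/negbTE; rewrite -leNgt ler_pdivrMr//.
      have : 1 / 2 <= t n by rewrite tE /a q1 div1r lef_pV2 ?posrE; lra.
      by nra.
    congr (_ + _); congr (nat_of_bool _)%:R.
    have tt : 0 < 1 - t n by lra.
    by rewrite ltr_pdivrMr// ltr_pdivlMr//; apply/idP/idP; nra.
  - by rewrite big_nil.
Qed.

(** The OCF digit of y has sign -1 and the OCF image of y exceeds 1 - c. *)
Definition flipped c (y : R) := ~~ odd (quot y) && (y^-1 - (quot y)%:R < c).

Let flipped_inv c j n : (0 < j)%N ->
  flipped c (j%:R + t n)^-1 = ~~ odd j && (t n < c).
Proof.
move=> j0; have ht := rcf_orbit_Omega hx n.
have qE : quot (j%:R + t n)^-1 = j by exact: (quot_branch pred0 j0 ht).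
by rewrite /flipped qE invrK addrAC subrr add0r.
Qed.

(** Phase Mirror is entered, possibly from itself, exactly when the OCF remainder just emitted has a
    digit with sign -1.  For an entry from phase Wait this remainder was
    emitted one step earlier, which shift invariance absorbs. *)
Lemma mirror_cdf_flipped c :
  mirror_cdf c = m (fun n => \sum_(y <- emitted_at x n) \1(flipped c y)).
Proof.
pose f1 n : R := \1(is_direct (s n) && ~~ odd (a n)) * \1(t n.+1 < c).
pose f2 n : R := \1([&& is_mirror (s n), a n != 1%N & odd (a n)]) * \1(t n.+1 < c).
pose f3 n : R := \1(is_wait (s n) && odd (a n)) * \1(t n.+1 < c).
have b1 : bounded_seq f1 by exact: bnd_ind. have b2 : bounded_seq f2 by exact: bnd_ind.
have b3 : bounded_seq f3 by exact: bnd_ind.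
have b12 := bndD b1 b2.
have b3S : bounded_seq (fun n => f3 n.+1) by have [M hM] := b3; exists M => n.
transitivity (m (fun n => f1 n + f2 n + f3 n)).
  rewrite /mirror_cdf -(mean_shift1 hm)//; congr m; apply/funext => n.
  rewrite /f1 /f2 /f3 /s /= -/(s n) -/(t n) -/(a n).
  case: (s n) => /=; rewrite ?mul0r ?addr0 ?add0r.
  - by case: (odd _) => /=; rewrite ?mul0r.
  - by case: eqP => //= _; case: (odd _).
  - by case: (odd _).
rewrite (meanD hm b12 b3) -(mean_shift1 hm b3) -(meanD hm b12 b3S).
congr m; apply/funext => n; rewrite /f1 /f2 /f3 /emitted_at.
have ht := rcf_orbit_Omega hx n; have [t0 t1 _ a0] := orbit_facts n.
rewrite (_ : s n.+1 = next_phase (s n) (a n))// -/(s n) -/(t n).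
case: (s n); rewrite /next_phase /emitted /is_direct /is_mirror /is_wait ?mul0r ?addr0 ?add0r.
- rewrite big_seq1 [in RHS](orbit_step n) flipped_inv//.
  by case: (odd (a n)); case: (t n.+1 < c); rewrite /= ?mul0r ?mul1r ?addr0.
- rewrite -/(a n); case: eqP => [a1|/eqP a1].
    rewrite big_seq1 (_ : 1 - t n = (((a n.+1).+1)%:R + t n.+2)^-1); last first.
      by rewrite (mirror_one ht a1) (wait_ratio (rcf_orbit_Omega hx n.+1)).
    rewrite flipped_inv// oddS negbK.
    by case: (odd (a n.+1)); case: (t n.+2 < c); rewrite /= ?mul0r ?mul1r ?addr0 ?add0r.
  have q1 : (0 < (a n).-1)%N by move: (a n) a0 a1 => [|[|]].
  have hr : t n / (1 - t n) = (((a n).-1)%:R + t n.+1)^-1 := mirror_ratio ht a1.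
  have E1 : flipped c (1 - t n) = false.
    have tE : 1 - t n = (1%:R + t n / (1 - t n))^-1.
      have n0 : 1 - t n != 0 by rewrite gt_eqF//; lra.
      by field; rewrite n0 addrNK oner_neq0.
    rewrite /flipped tE (quot_branch pred0 (j := 1))//.
    by rewrite hr; exact: (branch_Omega pred0 q1 (rcf_orbit_Omega hx n.+1)).
  rewrite !big_cons big_nil addr0 E1 add0r hr flipped_inv//.
  have -> : odd (a n).-1 = ~~ odd (a n) by case: (a n) a0 => //= k _; rewrite negbK.
  by case: (odd (a n)); case: (t n.+1 < c); rewrite /= ?mul0r ?mul1r ?addr0.
- by rewrite big_nil; case: (odd (a n)); rewrite /= mul0r.
Qed.


(** The density 1 / (G + t) in phase Mirror turns the phase relations into the
    addition rules for logarithms above, because G^2 = G + 1. *)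
Section GoldenMirror.
Variable kappa : R.
Hypothesis mirrorE : forall c, rational c -> 0 <= c <= 1 ->
  mirror_cdf c = kappa * (ln (G + c) - ln G).

Let r1 : rational (1 : R). Proof. exact: (rational_nat R 1). Qed.
Let one01 : 0 <= (1 : R) <= 1. Proof. by rewrite ler01 lexx. Qed.

Lemma golden_wait c : rational c -> 0 <= c <= 1 ->
  wait_cdf c = kappa * (ln (1 + c) - ln (G + c) + ln G).
Proof.
move=> rc c01; have /andP[c0 c1] := c01; rewrite wait_cdfE// !mirrorE//.
- by rewrite ln_golden_inv// ln_golden1; ring.
- by apply/rationalV/rationalD.
- by rewrite invr_ge0 invf_le1; lra.
Qed.

Lemma golden_emitted c : rational c -> 0 <= c <= 1 ->
  emitted_cdf c = direct_cdf c - kappa * ln (1 + c) +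
    kappa * (3 * ln G) * ocf_cdf c.
Proof.
move=> rc c01; have /andP[c0 c1] := c01; rewrite emitted_cdfE// !mirrorE//.
- rewrite ln_golden_ratio// ln_golden1 [G + (1 - c)]addrA /ocf_cdf ln_golden_mirror//.
  have G0 := ln_golden_gt0 R; rewrite -[kappa * _ * _]mulrA [3 * _ * _]mulrCA divff.
    by ring.
  by rewrite gt_eqF// mulr_gt0.
- by apply: rationalM => //; apply/rationalV/rationalD.
- by rewrite divr_ge0 ?ler_pdivrMr; lra.
- exact: rationalB.
- lra.
Qed.

End GoldenMirror.

Lemma vanishing_of_small (z k : R) : 0 <= k ->
  (forall n : nat, `|z| <= k * n.+1%:R^-1) -> z = 0.
Proof.
move=> k0 h; apply/eqP; rewrite -normr_eq0 eq_le normr_ge0 andbT.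
rewrite leNgt; apply/negP => z0.
have z2 : 0 < `|z| / 2 by rewrite divr_gt0.
have [n hn] := small_fraction z2 k0.
by have := le_trans (h n) hn; lra.
Qed.

Lemma ln_increment (b c : R) : 0 < b -> b <= c -> 0 <= ln c - ln b <= (c - b) / b.
Proof.
move=> b0 bc; rewrite -ln_div ?posrE; [|lra|lra].
have -> : c / b = 1 + (c - b) / b by field; rewrite gt_eqF.
have h0 : 0 <= (c - b) / b by rewrite divr_ge0; lra.
by rewrite ln_ge0 ?lerDl//= le_ln1Dx//; lra.
Qed.

(** * From regular to odd continued fractions *)

Section FromRcf.
Hypothesis rcf_equi : forall c, rational c -> 0 <= c <= 1 ->
  m (fun n => \1(t n < c)) = rcf_cdf c.

Let kappa : R := (ln 2)^-1 / 2.
Let defect c := mirror_cdf c - kappa * (ln (G + c) - ln G).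

Let kappa_gt0 : 0 < kappa.
Proof. by rewrite divr_gt0 ?invr_gt0 ?ln_gt0//; lra. Qed.

Let directE c : rational c -> 0 <= c <= 1 -> direct_cdf c = kappa * ln (1 + c).
Proof.
by move=> rc c01; rewrite /direct_cdf mean_direct// /rcf_cdf /kappa; ring.
Qed.

(** The total mass relation, in which the candidate solution cancels. *)
Let defect_inv c : rational c -> 0 <= c <= 1 ->
  defect (1 + c)^-1 = defect c + defect 1.
Proof.
move=> rc c01; have /andP[c0 c1] := c01.
have := total_cdf c; rewrite rcf_equi// directE// wait_cdfE// /defect.
rewrite ln_golden_inv// ln_golden1.
have -> : rcf_cdf c = 2 * (kappa * ln (1 + c)) by rewrite /kappa /rcf_cdf; field; rewrite gt_eqF// ln_gt0//; lra.
by lra.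
Qed.

Let defect_lip b c : rational b -> rational c -> 0 <= b -> b <= c -> c <= 1 ->
  `|defect c - defect b| <= 3 * kappa * (c - b).
Proof.
move=> rb rc b0 bc c1.
have c01 : 0 <= c <= 1 by rewrite (le_trans b0 bc). have b01 : 0 <= b <= 1 by rewrite b0 (le_trans bc).
have mono n : (\1(t n < b) : R) <= \1(t n < c).
  by case: ltP => tb //; rewrite (lt_le_trans tb bc).
have bt y : bounded_seq (fun n => \1(t n < y) : R) by exact: bnd_nat.
have h1 : 0 <= mirror_cdf c - mirror_cdf b.
  rewrite /mirror_cdf -meanB//; apply: mean_ge0 => // [|n]; first by apply: bndD => //; exact: bndN.
  by rewrite -mulrBr mulr_ge0// subr_ge0.
have h2 : mirror_cdf c - mirror_cdf b <= rcf_cdf c - rcf_cdf b.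
  rewrite -!rcf_equi// /mirror_cdf -!meanB//; apply: mean_le => // [||n].
  - by apply: bndD => //; exact: bndN.
  - by apply: bndD => //; exact: bndN.
  - by rewrite -mulrBr ler_piMl ?subr_ge0//; case: (is_mirror _).
have h3 := rcf_cdf_lip b0 bc.
have /andP[h4 h5] : 0 <= ln (G + c) - ln (G + b) <= c - b.
  have /andP[G1 _] := golden_itv R; have Gb : 0 < G + b by lra.
  have /andP[-> h] : 0 <= ln (G + c) - ln (G + b) <= (G + c - (G + b)) / (G + b).
    by apply: ln_increment => //; lra.
  by apply: (le_trans h); rewrite ler_pdivrMr//; nra.
have h6 : 0 <= kappa * (ln (G + c) - ln (G + b)) <= kappa * (c - b).
  by rewrite mulr_ge0 ?(ltW kappa_gt0)//= ler_wpM2l ?(ltW kappa_gt0).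
have h7 : (ln 2)^-1 * (c - b) = 2 * (kappa * (c - b)) by rewrite /kappa; field; rewrite gt_eqF// ln_gt0//; lra.
rewrite /defect ler_norml -mulrA; apply/andP; split; lra.
Qed.

(** Increments of the defect are invariant under c |-> 1 / (1 + c), whose
    square contracts by 1/4.  As the defect is Lipschitz, it is constant, and
    it vanishes at 0. *)
Lemma mirror_of_rcf c : rational c -> 0 <= c <= 1 ->
  mirror_cdf c = kappa * (ln (G + c) - ln G).
Proof.
have inv01 (y : R) : rational y -> 0 <= y <= 1 -> rational (1 + y)^-1 /\ 0 <= (1 + y)^-1 <= 1.
  move=> ry /andP[y0 y1]; split; first by apply: rationalV; apply: rationalD => //; exact: (rational_nat R 1).
  by rewrite invr_ge0 invf_le1; lra.
have key n : forall b c, rational b -> rational c -> 0 <= b -> b <= c -> c <= 1 ->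
    `|defect c - defect b| <= 3 * kappa * (c - b) * n.+1%:R^-1.
  elim: n => [|n IH] {}b {}c rb rc b0 bc c1; first by rewrite invr1 mulr1; exact: defect_lip.
  have b01 : 0 <= b <= 1 by rewrite b0 (le_trans bc).
  have c01 : 0 <= c <= 1 by rewrite (le_trans b0 bc).
  have [rb1 b1] := inv01 _ rb b01; have [rc1 c11] := inv01 _ rc c01.
  have [rb2 b2] := inv01 _ rb1 b1; have [rc2 c2] := inv01 _ rc1 c11.
  (* the factor 1/4 is more than enough to pass from 1/(n+1) to 1/(n+2) *)
  have -> : defect c - defect b = defect (1 + (1 + c)^-1)^-1 - defect (1 + (1 + b)^-1)^-1.
    by rewrite !defect_inv//; ring.
  have Ed : (1 + (1 + c)^-1)^-1 - (1 + (1 + b)^-1)^-1 = (c - b) / ((2 + c) * (2 + b)).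
    by field; do ?[apply/andP; split]; rewrite gt_eqF//; lra.
  have d4 : (c - b) / ((2 + c) * (2 + b)) <= (c - b) / 4.
    rewrite ler_wpM2l ?subr_ge0// lef_pV2 ?posrE ?mulr_gt0//; [nra|lra|lra].
  have d0 : 0 <= (c - b) / ((2 + c) * (2 + b)) by rewrite divr_ge0 ?subr_ge0// mulr_ge0; lra.
  have /andP[b20 _] := b2; have /andP[_ c21] := c2.
  apply: (le_trans (IH _ _ rb2 rc2 b20 _ c21)); first by rewrite -subr_ge0 Ed.
  have k3 : 0 <= 3 * kappa by rewrite mulr_ge0// ltW.
  rewrite Ed -[leLHS]mulrA -[leRHS]mulrA ler_wpM2l//.
  apply: (@le_trans _ _ ((c - b) / 4 * n.+1%:R^-1)).
    by rewrite ler_wpM2r// invr_ge0.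
  rewrite -mulrA ler_wpM2l ?subr_ge0// -invfM lef_pV2 ?posrE ?mulr_gt0 ?ltr0n//.
  by have n0 : 0 <= n%:R :> R by []; rewrite -[n.+2%:R]natr1 -[n.+1%:R]natr1; lra.
move=> rc c01; have /andP[c0 c1] := c01.
have r0 : rational (0 : R) by exact: (rational_nat R 0).
have k0 : 0 <= 3 * kappa * (c - 0) by rewrite subr0 mulr_ge0// mulr_ge0// ltW.
have z0 : mirror_cdf 0 = 0.
  rewrite /mirror_cdf -[RHS](mean_zero hm); congr m.
  by apply/funext => n; have [t0 _ _ _] := orbit_facts n; rewrite lt_gtF// mulr0.
have d0 : defect 0 = 0 by rewrite /defect z0 addr0 subrr mulr0 subr0.
have : defect c - defect 0 = 0.
  by apply: (vanishing_of_small k0) => n; exact: (key n 0 c r0 rc (lexx _) c0 c1).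
by move/eqP; rewrite d0 subr0 subr_eq0 => /eqP.
Qed.

Lemma emitted_of_rcf c : rational c -> 0 <= c <= 1 ->
  emitted_cdf c = emitted_cdf 1 * ocf_cdf c.
Proof.
have E y : rational y -> 0 <= y <= 1 -> emitted_cdf y = kappa * (3 * ln G) * ocf_cdf y.
  by move=> ry y01; rewrite (golden_emitted mirror_of_rcf)// directE// subrr add0r.
have o1 : 0 <= (1 : R) <= 1 by rewrite ler01 lexx.
by move=> rc c01; rewrite !E ?ocf_cdf1 ?mulr1//; exact: (rational_nat R 1).
Qed.

End FromRcf.

(** * From odd to regular continued fractions *)

Section FromOcf.
Hypothesis ocf_equi : forall c, rational c -> 0 <= c <= 1 ->
  emitted_cdf c = emitted_cdf 1 * ocf_cdf c.

Let kappa : R := emitted_cdf 1 / (3 * ln G).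

Let slab c j (y : R) : R := \1(y < j%:R^-1) - \1(y < (j%:R + c)^-1).

(** The points with quotient j and fractional part of the inverse below c form
    one interval. *)
Let slabE c j y : (0 < j)%N -> rational c -> 0 <= c <= 1 -> Omega y ->
  slab c j y = \1((quot y == j) && (y^-1 - (quot y)%:R < c)).
Proof.
move=> j0 rc /andP[c0 c1] hy; have [q0 q1 q2] := quot_itv hy; have /OmegaP[y0 y1 ny] := hy.
have x0 : 0 < j%:R :> R by rewrite ltr0n.
have v0 : 0 < y^-1 by rewrite invr_gt0.
have E1 : (y < j%:R^-1) = (j%:R < y^-1) by rewrite -{1}[y]invrK ltf_pV2 ?posrE.
have E2 : (y < (j%:R + c)^-1) = (j%:R + c < y^-1).
  by rewrite -{1}[y]invrK ltf_pV2 ?posrE// ltr_wpDr.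
have ne : y^-1 != (quot y)%:R + c.
  apply/eqP => E; apply: ny; rewrite -[y]invrK E; apply: rationalV.
  by apply: rationalD => //; exact: rational_nat.
rewrite /slab E1 E2; have [lt|gt|eq] := ltngtP (quot y) j.
- have h : y^-1 < j%:R by apply: (lt_le_trans q2); rewrite ler_nat.
  by rewrite (lt_gtF h) (lt_gtF (lt_le_trans h _)) ?subrr// lerDl.
- have h : j%:R + 1 <= (quot y)%:R :> R by rewrite natr1 ler_nat.
  have h1 : j%:R + c < y^-1 by apply: le_lt_trans q1; apply: le_trans h; rewrite lerD2l.
  by rewrite h1 (le_lt_trans _ h1) ?subrr// lerDl.
- rewrite -eq q1 /= ltrBlDl.
  by case: (ltgtP (y^-1) _) ne; rewrite ?subrr ?subr0.
Qed.

Let sum_slab c J y : rational c -> 0 <= c <= 1 -> Omega y ->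
  \sum_(i < J) slab c i.*2.+2 y = \1(flipped c y && (quot y <= J.*2)%N).
Proof.
move=> rc c01 hy; have [q0 _ _] := quot_itv hy.
elim: J => [|J IH]; first by rewrite big_ord0 leqNgt q0 andbF.
rewrite big_ord_recr/= IH slabE// /flipped.
case: (_ < c); rewrite ?andbF ?andbT ?addr0//.
have [->|qn] := eqVneq (quot y) J.*2.+2.
  have -> : (J.*2.+2 <= J.*2)%N = false by lia.
  by rewrite doubleS leqnn !oddS negbK odd_double /= add0r.
rewrite addr0; congr (nat_of_bool _)%:R; case: (boolP (odd (quot y))) => //= ev.
have : quot y != J.*2.+1 by apply: contra ev => /eqP ->; rewrite oddS odd_double.
by move: qn; rewrite doubleS; lia.
Qed.

Lemma emitted_Omega n : {in emitted_at x n, forall y, Omega y}.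
Proof.
have ht := rcf_orbit_Omega hx n; move=> y.
rewrite /emitted_at emitted_traject// => /trajectP[i _ ->].
have -> : iter i (cfmap (fun j => ~~ odd j)) (pending (phase_at x n) (rcf_orbit x n)) =
   ocf_orbit x (i + clock x n).
  by rewrite /ocf_orbit iterD -/(ocf_orbit x _) ocf_orbit_clock.
by rewrite /ocf_orbit; elim: (_ + _)%N => //= k IH; exact: cfmap_Omega.
Qed.

Let slab_cdf c j : emitted_cdf j%:R^-1 - emitted_cdf (j%:R + c)^-1 =
  m (fun n => \sum_(y <- emitted_at x n) slab c j y).
Proof.
rewrite /emitted_cdf -meanB//; try by apply: bnd_emitted => y; exact: norm_ind.
by congr m; apply/funext => n; rewrite -sumrB.
Qed.

Let inv01 (u : R) : rational u -> 1 <= u -> rational u^-1 /\ 0 <= u^-1 <= 1.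
Proof.
by move=> ru u1; split; [exact: rationalV|rewrite invr_ge0 invf_le1; lra].
Qed.

Let emitted_inv u : rational u -> 1 <= u ->
  emitted_cdf u^-1 = kappa * (ln (u + G) - ln (u + G - 2)).
Proof.
move=> ru u1; have [rv v01] := inv01 ru u1.
by rewrite ocf_equi// ocf_cdf_inv// /kappa mulrAC mulrA.
Qed.

Let log_slabs c J : rational c -> 0 <= c <= 1 ->
  \sum_(i < J) (emitted_cdf (i.*2.+2)%:R^-1 - emitted_cdf ((i.*2.+2)%:R + c)^-1) =
  kappa * (ln (J.*2%:R + G) - ln (J.*2%:R + c + G) + (ln (G + c) - ln G)).
Proof.
move=> rc /andP[c0 c1]; elim: J => [|J IH].
  by rewrite big_ord0 double0 !add0r [c + G]addrC; ring.
rewrite big_ord_recr/= IH doubleS.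
have j1 : 1 <= (J.*2.+2)%:R :> R by rewrite ler1n.
have jE : (J.*2.+2)%:R = J.*2%:R + 2 :> R by rewrite -!natr1; ring.
rewrite !emitted_inv//; try (by apply: rationalD => //; exact: rational_nat).
- move: j1; rewrite jE; move: (J.*2%:R) => u j1.
  have -> : u + 2 + G - 2 = u + G by ring.
  have -> : u + 2 + c + G - 2 = u + c + G by ring.
  by ring.
- exact: rational_nat.
- by rewrite (le_trans j1)// lerDl.
Qed.

Let kappa_ge0 : 0 <= kappa.
Proof.
rewrite divr_ge0 ?mulr_ge0// ?(ltW (ln_golden_gt0 _))//.
apply: mean_ge0 => // [|n]; last by apply: sumr_ge0 => y _.
by apply: bnd_emitted => y; exact: norm_ind.
Qed.

(** The points flipped below c are the slabs of even quotients.  Their OCF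
    masses telescope (log_slabs); the slabs beyond 2J lie below 1/(2J+2),
    whose mass tends to 0 like 1/J. *)
Lemma mirror_of_ocf c : rational c -> 0 <= c <= 1 ->
  mirror_cdf c = kappa * (ln (G + c) - ln G).
Proof.
move=> rc c01; have /andP[c0 c1] := c01.
have be (p : R -> bool) : bounded_seq (fun n => \sum_(y <- emitted_at x n) \1(p y) : R).
  by apply: bnd_emitted => y; exact: norm_ind.
have bs j : bounded_seq (fun n => \sum_(y <- emitted_at x n) slab c j y).
  have [K hK] := be (fun y => y < j%:R^-1); have [L hL] := be (fun y => y < (j%:R + c)^-1).
  by exists (K + L) => n; rewrite sumrB (le_trans (ler_normB _ _))// lerD.
have pointwise J n : \sum_(i < J) (\sum_(y <- emitted_at x n) slab c i.*2.+2 y) =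
    \sum_(y <- emitted_at x n) \1(flipped c y && (quot y <= J.*2)%N).
  rewrite exchange_big/=; apply: eq_big_seq => y /emitted_Omega hy.
  exact: sum_slab.
have lower J : kappa * (ln (J.*2%:R + G) - ln (J.*2%:R + c + G) + (ln (G + c) - ln G)) <= mirror_cdf c.
  rewrite -log_slabs// mirror_cdf_flipped; under eq_bigr do rewrite slab_cdf.
  rewrite -mean_sum//; apply: mean_le => // [|n]; first exact: bnd_sum.
  rewrite pointwise; apply: ler_sum => y _.
  by case: (flipped c y); case: (_ <= _)%N.
have upper J : mirror_cdf c <= kappa * (ln (J.*2%:R + G) - ln (J.*2%:R + c + G) +
    (ln (G + c) - ln G)) + emitted_cdf (J.*2.+2)%:R^-1.
  rewrite -log_slabs// mirror_cdf_flipped; under eq_bigr do rewrite slab_cdf.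
  rewrite -mean_sum// -meanD//; last exact: bnd_sum.
  apply: mean_le => // [|n]; first by apply: bndD => //; exact: bnd_sum.
  rewrite pointwise -big_split/= !big_seq; apply: ler_sum => y /emitted_Omega hy.
  have [q0 q1 q2] := quot_itv hy; have /OmegaP[y0 _ _] := hy.
  have [fy|_] := boolP (flipped c y); last by rewrite add0r.
  case: leqP => [_|qJ] /=; first by rewrite lerDl.
  have qJ2 : (J.*2.+2 <= quot y)%N.
    move: fy qJ => /andP[ev _]; rewrite leq_eqVlt => /orP[/eqP qE|//].
    by move: ev; rewrite -qE oddS odd_double.
  rewrite add0r (_ : y < _ = true)//.
  rewrite -[y]invrK ltf_pV2 ?posrE ?invr_gt0 ?ltr0n//.
  by apply: le_lt_trans q1; rewrite ler_nat.
have k2 : 0 <= kappa * 2 by rewrite mulr_ge0 ?kappa_ge0.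
apply/eqP; rewrite -subr_eq0; apply/eqP; apply: (vanishing_of_small k2) => J.
move: (lower J) (upper J); have /andP[G1 G2] := golden_itv R.
have uE : (J.*2)%:R = 2 * J%:R :> R by rewrite -mul2n natrM.
have J0 : 0 <= J%:R :> R by [].
rewrite emitted_inv; last 2 first.
- exact: rational_nat.
- by rewrite ler1n.
have -> : (J.*2.+2)%:R = 2 * J%:R + 2 :> R by rewrite -!natr1 uE; ring.
rewrite -[J.+1%:R]natr1 uE; move: (J%:R) J0 => v v0.
have -> : 2 * v + 2 + G - 2 = 2 * v + G by ring.
have vG : 0 < 2 * v + G by lra.
have /andP[d1 _] : 0 <= ln (2 * v + c + G) - ln (2 * v + G) <= (2 * v + c + G - (2 * v + G)) / (2 * v + G).
  by apply: ln_increment => //; lra.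
have /andP[e1 e2] : 0 <= ln (2 * v + 2 + G) - ln (2 * v + G) <= (2 * v + 2 + G - (2 * v + G)) / (2 * v + G).
  by apply: ln_increment => //; lra.
have d3 : ln (2 * v + c + G) - ln (2 * v + G) <= ln (2 * v + 2 + G) - ln (2 * v + G).
  by rewrite lerD2r ler_ln ?posrE; lra.
have e3 : ln (2 * v + 2 + G) - ln (2 * v + G) <= 2 * (v + 1)^-1.
  apply: (le_trans e2); have -> : 2 * v + 2 + G - (2 * v + G) = 2 by ring.
  by rewrite ler_wpM2l// lef_pV2 ?posrE; lra.
have k0 := kappa_ge0.
have D : kappa * (ln (2 * v + 2 + G) - ln (2 * v + G)) <= kappa * 2 * (v + 1)^-1.
  by rewrite -mulrA ler_wpM2l.
have d4 : kappa * (ln (2 * v + c + G) - ln (2 * v + G)) <= kappa * (ln (2 * v + 2 + G) - ln (2 * v + G)).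
  by rewrite ler_wpM2l.
have d5 : 0 <= kappa * (ln (2 * v + c + G) - ln (2 * v + G)) by rewrite mulr_ge0.
move=> lo up; rewrite ler_norml; apply/andP; split; lra.
Qed.

(** All phases are now known up to the common factor kappa, which is fixed by
    the total mass 1. *)
Lemma rcf_of_ocf c : rational c -> 0 <= c <= 1 -> m (fun n => \1(t n < c)) = rcf_cdf c.
Proof.
have E y : rational y -> 0 <= y <= 1 -> m (fun n => \1(t n < y)) = 2 * kappa * ln (1 + y).
  move=> ry y01; rewrite total_cdf (golden_wait mirror_of_ocf)// mirror_of_ocf//.
  have := golden_emitted mirror_of_ocf ry y01; rewrite ocf_equi//.
  have -> : kappa * (3 * ln G) = emitted_cdf 1.
    by rewrite /kappa divfK// gt_eqF// mulr_gt0// ln_golden_gt0.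
  move=> h; have -> : direct_cdf y = kappa * ln (1 + y) by lra.
  by ring.
move=> rc c01; rewrite E//.
have r1 : rational (1 : R) by exact: (rational_nat R 1).
have o1 : 0 <= (1 : R) <= 1 by rewrite ler01 lexx.
have := E 1 r1 o1.
have -> : (fun n => \1(t n < 1)) = (fun=> 1 : R).
  by apply/funext => n; have [_ -> _ _] := orbit_facts n.
rewrite mean_one// => k1; rewrite /rcf_cdf.
have l2 : 0 < ln (2 : R) by rewrite ln_gt0//; lra.
have -> : 2 * kappa = (ln 2)^-1.
  by apply: (mulIf (lt0r_neq0 l2)); rewrite mulVf ?lt0r_neq0// k1; congr (_ * ln _); ring.
by rewrite mulrC.
Qed.

End FromOcf.

End PhaseDistributions.

(** * The two expansions *)

Section Specialization.
Variable R : realType.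
Implicit Types (x y c : R).

Lemma T_RCF_cfmap x : Omega x -> T_RCF x = cfmap pred0 x.
Proof. by move=> hx; rewrite /T_RCF /cfmap/= quot_floor. Qed.

Lemma T_OCF_cfmap x : Omega x -> T_OCF x = cfmap (fun j => ~~ odd j) x.
Proof.
move=> hx; rewrite /T_OCF /cfmap/= -/(quot x) quot_floor// if_neg.
by case: (odd _) => //; ring.
Qed.

Lemma quot_eqP x j : (0 < j)%N -> Omega x ->
  quot x = j <-> j.+1%:R^-1 < x < j%:R^-1.
Proof.
move=> j0 hx; have [_ q1 q2] := quot_itv hx; have /OmegaP[x0 _ _] := hx.
have p1 : 0 < j.+1%:R :> R by rewrite ltr0n.
have p0 : 0 < j%:R :> R by rewrite ltr0n.
have E1 : (j.+1%:R^-1 < x) = (x^-1 < j.+1%:R) by rewrite -{1}[x]invrK ltf_pV2 ?posrE ?invr_gt0.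
have E2 : (x < j%:R^-1) = (j%:R < x^-1) by rewrite -{1}[x]invrK ltf_pV2 ?posrE ?invr_gt0.
rewrite E1 E2; split=> [<-|/andP[h1 h2]]; first by rewrite q1 q2.
by apply: quot_eq; rewrite (ltW h2) h1.
Qed.

Lemma lt_le_irrational x c : ~ rational x -> rational c -> (x < c) = (x <= c).
Proof. by move=> nx rc; rewrite le_eqVlt (negbTE (irrational_neq nx rc)). Qed.

Lemma le_lt_irrational x c : ~ rational x -> rational c -> (c < x) = (c <= x).
Proof. by move=> nx rc; rewrite le_eqVlt eq_sym (negbTE (irrational_neq nx rc)). Qed.

Lemma I_RCF_quot (d : digit_RCF) x : I_RCF d x <-> Omega x /\ quot x = val d.
Proof.
have rinv n : rational ((n%:R : R)^-1) by apply: rationalV; exact: rational_nat.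
rewrite /I_RCF; split=> [[/= + hx]|[hx /(quot_eqP (valP d) hx)]]; last first.
  by move=> /andP[h1 h2]; split=> //=; rewrite in_itv/= natr1 h1 ltW.
have /OmegaP[_ _ nx] := hx; rewrite in_itv/= natr1 => /andP[h1 h2]; split=> //.
by apply/(quot_eqP (valP d) hx); rewrite h1 (lt_le_irrational nx).
Qed.

Lemma rcf_cdf0 : rcf_cdf (0 : R) = 0.
Proof. by rewrite /rcf_cdf addr0 ln1 mul0r. Qed.

Lemma RCF_equidistributed x : Omega x ->
  RCF_normal x <-> equidistributed (rcf_orbit x) (@rcf_cdf R).
Proof.
move=> hx; rewrite /RCF_normal.
have surj j : (0 < j)%N -> exists d : digit_RCF, val d = j.
  by move=> j0; exists (exist _ j j0).
have := normal_equidistributed T_RCF_cfmap I_RCF_quot (fun d => valP d) surj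
  (@mu_RCF_between R) rcf_cdf0 hx.
have -> : (fun n => iter n (@T_RCF R) x) = rcf_orbit x.
  by apply/funext => n; have [->] := iter_cfmap T_RCF_cfmap n hx.
by [].
Qed.

(** The quotient of the points with OCF digit (a, 1) is a, and a - 1 for the
    digit (a, -1). *)
Definition quot_of_OCF (d : digit_OCF) : nat :=
  if (val d).2 == 1 then (val d).1 else (val d).1.-1.

Lemma quot_of_OCF_gt0 d : (0 < quot_of_OCF d)%N.
Proof.
case: d => -[n s] /= h; have := h; rewrite /is_digit_OCF/= /quot_of_OCF/=.
move=> /and3P[on /orP[]/eqP -> ]; first by rewrite eqxx; case: (n) on.
by case: (n) on => [|[|[|k]]].
Qed.

Lemma quot_of_OCF_surj j : (0 < j)%N -> exists d, quot_of_OCF d = j.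
Proof.
move=> j0; case oj : (odd j).
  have h : is_digit_OCF (j, 1) by rewrite /is_digit_OCF/= oj xpair_eqE andbF.
  by exists (exist (fun d => is_digit_OCF d : Prop) _ h).
have h : is_digit_OCF (j.+1, -1).
  by rewrite /is_digit_OCF/= oj xpair_eqE; case: (j) j0.
by exists (exist (fun d => is_digit_OCF d : Prop) _ h).
Qed.

Lemma I_OCF_quot (d : digit_OCF) x : I_OCF d x <-> Omega x /\ quot x = quot_of_OCF d.
Proof.
have rinv n : rational ((n%:R : R)^-1) by apply: rationalV; exact: rational_nat.
have q0 := quot_of_OCF_gt0 d.
have E : (if (val d).2 == 1 then `[((val d).1%:R + 1)^-1, (val d).1%:R^-1[%classic
   else `[(val d).1%:R^-1, ((val d).1%:R - 1)^-1[%classic) =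
   `[(quot_of_OCF d).+1%:R^-1, (quot_of_OCF d)%:R^-1[%classic :> set R.
  rewrite /quot_of_OCF in q0 *; case: ifP q0 => _ q0; first by rewrite natr1.
  by rewrite -subn1 natrB ?subnK//; case: (val d).1 q0 => // -[].
rewrite /I_OCF E; split=> [[/= + hx]|[hx /(quot_eqP q0 hx)]]; last first.
  by move=> /andP[h1 h2]; split=> //=; rewrite in_itv/= h2 ltW.
have /OmegaP[_ _ nx] := hx; rewrite in_itv/= => /andP[h1 h2]; split=> //.
by apply/(quot_eqP q0 hx); rewrite h2 (le_lt_irrational nx) ?h1.
Qed.

Lemma ocf_cdf0 : ocf_cdf (0 : R) = 0.
Proof. by rewrite /ocf_cdf !mulr0 addr0 subr0 subrr mul0r. Qed.

Lemma OCF_equidistributed x : Omega x ->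
  OCF_normal x <-> equidistributed (ocf_orbit x) (@ocf_cdf R).
Proof.
move=> hx; rewrite /OCF_normal.
have := normal_equidistributed T_OCF_cfmap I_OCF_quot quot_of_OCF_gt0 quot_of_OCF_surj
  (@mu_OCF_between R) ocf_cdf0 hx.
have -> : (fun n => iter n (@T_OCF R) x) = ocf_orbit x.
  by apply/funext => n; have [->] := iter_cfmap T_OCF_cfmap n hx.
by [].
Qed.

Lemma rcf_equidistributed_mean x :
  equidistributed (rcf_orbit x) (@rcf_cdf R) <->
  forall U, UltraFilter U -> \oo `<=` U -> forall c, rational c -> 0 <= c <= 1 ->
    ultra_mean U (fun n => \1(rcf_orbit x n < c)) = rcf_cdf c.
Proof.
split=> [h U hU Uoo c rc c01|h c rc c01]; first exact/ultra_mean_eq/h.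
by apply/cesaro_mean_iff => [|U hU Uoo]; [exact: bnd_nat|exact: h].
Qed.

(** The mean of the emitted points at threshold 1 is the mean number of OCF
    steps per RCF step: the OCF frequency is a quotient of two RCF means. *)
Lemma ocf_equidistributed_mean x : Omega x ->
  equidistributed (ocf_orbit x) (@ocf_cdf R) <->
  forall U, UltraFilter U -> \oo `<=` U -> forall c, rational c -> 0 <= c <= 1 ->
    emitted_cdf x (ultra_mean U) c = emitted_cdf x (ultra_mean U) 1 * ocf_cdf c.
Proof.
move=> hx.
have ind1 (p : bool) : `|\1(p) : R| <= 1 by case: p; rewrite ?normr1 ?normr0.
have bc c : bounded_seq (fun n => \sum_(y <- emitted_at x n) \1(y < c) : R).
  by apply: bnd_emitted => y; exact: ind1.
have bl c (l : R) : bounded_seq (fun n => l * \sum_(y <- emitted_at x n) \1(y < c) : R).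
  by apply: bndM => //; exact: bnd_cst.
have sumE c n : \sum_(y <- emitted_at x n) (\1(y < c) - ocf_cdf c) =
    \sum_(y <- emitted_at x n) \1(y < c) -
    ocf_cdf c * \sum_(y <- emitted_at x n) \1(y < 1) :> R.
  rewrite sumrB mulr_sumr; congr (_ - _); apply: eq_big_seq => y yn.
  have /OmegaP[_ -> _] : Omega y by exact: (emitted_Omega hx yn).
  by rewrite mulr1.
have bd c : bounded_seq (fun n => \sum_(y <- emitted_at x n) (\1(y < c) - ocf_cdf c) : R).
  under eq_fun do rewrite sumE; apply: bndD => //; exact: bndN.
have meanE U c : UltraFilter U -> \oo `<=` U ->
    ultra_mean U (fun n => \sum_(y <- emitted_at x n) (\1(y < c) - ocf_cdf c)) =
    emitted_cdf x (ultra_mean U) c - ocf_cdf c * emitted_cdf x (ultra_mean U) 1.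
  move=> hU Uoo; have hm := ultra_mean_invariant R hU Uoo.
  by under eq_fun do rewrite sumE; rewrite meanB// meanZ.
have freq c : cesaro (fun k => \1(ocf_orbit x k < c)) @ \oo --> ocf_cdf c <->
    cesaro (fun n => \sum_(y <- emitted_at x n) (\1(y < c) - ocf_cdf c)) @ \oo --> (0 : R).
  apply: (@ocf_frequency R x hx (fun y => \1(y < c))) => y.
  by case: (y < c); rewrite ?lexx ?ler01.
split=> [h U hU Uoo c rc c01|h c rc c01].
  have /freq h0 := h c rc c01.
  have := ultra_mean_eq hU Uoo h0; rewrite meanE// => /eqP.
  by rewrite subr_eq0 mulrC => /eqP.
apply/freq/cesaro_mean_iff => // U hU Uoo.
by rewrite meanE// h// mulrC subrr.
Qed.

End Specialization.

Theorem theorem1p3 (R : realType) :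
  normal_equivalent (@RCF_normal R) (@OCF_normal R).
Proof.
move=> x hx.
apply: (iff_trans (RCF_equidistributed hx)); apply: iff_sym.
apply: (iff_trans (OCF_equidistributed hx)).
apply: (iff_trans (ocf_equidistributed_mean hx)); apply: iff_sym.
apply: (iff_trans (rcf_equidistributed_mean x)).
split=> h U hU Uoo; have hm := ultra_mean_invariant R hU Uoo.
  by move=> c rc c01; apply: emitted_of_rcf => //; exact: h.
by move=> c rc c01; apply: rcf_of_ocf => //; exact: h.
Qed.
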